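(* Let $x=[0;a_1,a_2,\dots]$ be CF-normal and let $S=\{s_1<s_2<\dots\}\subset\mathbb N$ be a non-superficial deterministic set. Then $[0;a_{s_1},a_{s_2},a_{s_3},\dots]$ is not CF-normal.
   Context: The Gauss map on $[0,1]$ is $G(x)=\{1/x\}$ (fractional part), preserving the Gauss measure $d\lambda=\frac{dx}{(1+x)\log 2}$; via continued fraction expansions $x=[0;a_1,a_2,\dots]$ it corresponds to the shift on $\mathbb N^{\mathbb N}$, and $\lambda$ is identified with the corresponding shift-invariant measure on $\mathbb N^{\mathbb N}$. $x$ is CF-normal if every finite block $(b_1,\dots,b_k)\in\mathbb N^k$ occurs in $(a_1,a_2,\dots)$ with limiting frequency equal to the $\lambda$-measure of the corresponding cylinder. With $y=\mathbbm1_S$, the measures derived from $S$ are the weak-* accumulation points of $\frac1n\sum_{i<n}\delta_{\sigma^iy}$ on $\{0,1\}^{\mathbb N}$; $S$ is deterministic if all of them have zero entropy; $S$ is superficial if all of them lie in $\mathrm{conv}\{\delta_{\bar0},\delta_{\bar1}\}$ (point masses at $0^\infty,1^\infty$), and non-superficial otherwise. *)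

(* Defs.v *)
From HB Require Import structures.
From mathcomp Require Import all_boot all_order all_algebra.
From mathcomp Require Import all_classical all_reals all_analysis.
Set Implicit Arguments. Unset Strict Implicit. Unset Printing Implicit Defensive.
Import Order.TTheory GRing.Theory Num.Theory.
Import numFieldNormedType.Exports.
Local Open Scope classical_set_scope.
Local Open Scope ring_scope.

Section CF.
Variable R : realType.

(* Gauss map G(x) = {1/x} (with the library convention 1/0 = 0, so G 0 = 0). *)
Definition gauss_map (x : R) : R := x^-1 - (Num.floor (x^-1))%:~R.

(* n-th partial quotient (0-indexed): cf_digit x n = a_{n+1}(x)
   = floor (1 / G^n x).  For irrational x in (0,1) these are the
   continued fraction digits x = [0; a_1, a_2, ...]. *)
Definition cf_digit (x : R) (n : nat) : nat := Num.truncn ((iter n gauss_map x)^-1).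

Definition cf_cylinder (b : seq nat) : set R :=
  [set u | 0 <= u <= 1 /\ forall j, (j < size b)%N -> cf_digit u j = nth 0%N b j].

Definition gauss_measure (A : set R) : \bar R :=
  (\int[@lebesgue_measure R]_(u in A) (((1 + u)^-1) / ln 2)%:E)%E.

Definition block_count (a : nat -> nat) (b : seq nat) (n : nat) : nat :=
  #|[set i : 'I_n | [forall j : 'I_(size b), a (i + j)%N == nth 0%N b j]]|.

Definition cf_normal_seq (a : nat -> nat) : Prop :=
  forall b : seq nat, all (fun c => (0 < c)%N) b ->
    (fun n : nat => (block_count a b n)%:R / n%:R : R) @ \oo -->
      fine (gauss_measure (cf_cylinder b)).

Definition cf_normal (x : R) : Prop := cf_normal_seq (cf_digit x).
End CF.

Definition cantorB := g_sigma_algebraType (@open cantor_space).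

Definition shift (y : cantor_space) (i : nat) : cantor_space := fun n => y (n + i)%N.

Section Derived.
Variable R : realType.

(* mu is a weak-* accumulation point of (1/n) sum_{i<n} delta_{sigma^i y}:
   along some subsequence, integrals of every continuous f converge. *)
Definition derived_measure (y : cantor_space) (mu : probability cantorB R) : Prop :=
  exists phi : nat -> nat, (forall k, (phi k < phi k.+1)%N) /\
    forall f : cantor_space -> R, continuous f ->
      (fun k => (phi k)%:R^-1 * \sum_(i < phi k) f (shift y i)) @ \oo -->
        fine (\int[mu]_z (f z)%:E)%E.

Definition bcyl (n : nat) (w : n.-tuple bool) : set cantorB :=
  [set z | forall i : 'I_n, z i = tnth w i].

Definition Hn (mu : probability cantorB R) (n : nat) : R :=
  - \sum_(w : n.-tuple bool) (fine (mu (bcyl w)) * ln (fine (mu (bcyl w)))).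

(* Kolmogorov-Sinai entropy of the shift (w.r.t. the generating partition)
   is zero: lim_n H_n / n = 0 *)
Definition zero_entropy (mu : probability cantorB R) : Prop :=
  (fun n : nat => Hn mu n.+1 / n.+1%:R) @ \oo --> (0 : R).

Definition indic (S : set nat) : cantor_space := fun n => `[< S n >].

Definition deterministic (S : set nat) : Prop :=
  forall mu : probability cantorB R, derived_measure (indic S) mu -> zero_entropy mu.

Definition in_conv01 (mu : probability cantorB R) : Prop :=
  exists t : R, 0 <= t <= 1 /\
    forall A : set cantorB, measurable A ->
      mu A = (t%:E * \d_((fun _ : nat => false) : cantorB) A
              + (1 - t)%:E * \d_((fun _ : nat => true) : cantorB) A)%E.

Definition superficial (S : set nat) : Prop :=
  forall mu : probability cantorB R, derived_measure (indic S) mu -> in_conv01 mu.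
End Derived.

(* Main.v *)
Require Import Defs.
From HB Require Import structures.
From mathcomp Require Import all_boot all_order all_algebra.
From mathcomp Require Import all_classical all_reals all_analysis.
From mathcomp Require Import measurable_realfun ring lra zify.
Import Order.TTheory GRing.Theory Num.Theory.
Import numFieldNormedType.Exports.
Local Open Scope classical_set_scope.
Local Open Scope ring_scope.

(** Along a subsequence realizing a derived measure [mu] of [S], a normal sequence and
    the indicator of [S] become independent: the Gauss system is mixing and [mu] has zero entropy,
    so this is an instance of Furstenberg's disjointness.  It is proved by counting.  For a window
    [v] of the indicator, let [W] be the sum over the selected times of [tau * occ w + ln r], where
    [r] bounds the conditional mean of [exp (- tau * occ w)].  By mixing [exp (- W)] has mean at
    most [1], hence [exp (ln (mu v) - W) >= 1 + ln (mu v) - W], averaged and summed over [v],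
    bounds the mean of [W] below by minus the entropy of [mu] on windows, which is sublinear.

    Mixing is obtained from the transfer operator of the Gauss map, which reverses monotonicity
    and halves the variation of monotone functions.

    Independence turns the frequency of [20 20] in the subsequence into an average, over the gaps
    [k] between consecutive elements of [S], of the Gauss probability of the digit [20] at
    times [0] and [k].  This probability is larger, by a fixed factor, for every [k > 1] than for
    [k = 1]; so if the subsequence is normal then [mu]-almost all gaps are [1], that is,
    [mu] is carried by the two constant sequences. *)

(** * Inverse branches of the Gauss map *)

Section InverseBranches.
Variable R : realType.
Implicit Types (u v w : seq nat) (t : R).

Definition posdigits u := all (fun c => (0 < c)%N) u.

(** The continued fraction [[0; u_1, ..., u_k + t]] with [k = size u]: the inverse branch of the
    [k]-th iterate of the Gauss map on the cylinder of [u]. *)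
Fixpoint branch u t : R :=
  if u is c :: u' then (c%:R + branch u' t)^-1 else t.

(* Conditional probability, under the Gauss measure, that the preceding partial
   quotient is [c] given that the continued fraction from now on is [t]. *)
Definition digit_prob (c : nat) t : R := (1 + t) / ((c%:R + t) * (c.+1%:R + t)).

(* Density, relative to the Gauss measure, of the pullback of the Gauss measure by [branch u]. *)
Fixpoint density u t : R :=
  if u is c :: u' then digit_prob c (branch u' t) * density u' t else 1.

Lemma branch_cat u v t : branch (u ++ v) t = branch u (branch v t).
Proof. by elim: u => //= c u ->. Qed.

Lemma density_cat u v t : density (u ++ v) t = density u (branch v t) * density v t.
Proof. by elim: u => [|c u IH] /=; rewrite ?mul1r // IH branch_cat mulrA. Qed.

Lemma posdigits_cat u v : posdigits (u ++ v) = posdigits u && posdigits v.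
Proof. exact: all_cat. Qed.

Lemma branch_ge0 u t : 0 <= t -> 0 <= branch u t.
Proof. by move=> t0; elim: u => //= c u IH; rewrite invr_ge0 addr_ge0. Qed.

Lemma branch_le1 u t : posdigits u -> 0 <= t <= 1 -> 0 <= branch u t <= 1.
Proof.
move=> + /andP[t0 t1]; elim: u => [|c u IH] /=; first by rewrite t0 t1.
move=> /andP[c0 /IH /andP[b0 b1]].
have c1 : 1 <= c%:R :> R by rewrite ler1n.
by rewrite invr_ge0 addr_ge0 // invf_le1; lra.
Qed.

Lemma digit_prob_gt0 c t : (0 < c)%N -> 0 <= t -> 0 < digit_prob c t.
Proof.
move=> c0 t0; have c1 : 1 <= c%:R :> R by rewrite ler1n.
rewrite /digit_prob divr_gt0 //; first lra.
by rewrite mulr_gt0 // -?natr1; lra.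
Qed.

Lemma density_gt0 u t : posdigits u -> 0 <= t -> 0 < density u t.
Proof.
move=> + t0; elim: u => [|c u IH] //= /andP[c0 /IH d0].
by rewrite mulr_gt0 // digit_prob_gt0 // branch_ge0.
Qed.

(** The sign undoes the orientation reversal of each inversion, so [primitive u] increases; up to
    the factor [ln 2] its increments are Gauss measures of images under [branch u]. *)
Definition primitive u t : R := (-1) ^+ size u * ln (1 + branch u t).

Definition loglen u : R := primitive u 1 - primitive u 0.

(** By induction: the factors of the Gauss density cancel between consecutive digits, leaving the
    derivative [- 1 / (c + z) ^ 2] of each inversion. *)
Lemma is_derive_ln_branch u t : posdigits u -> 0 <= t ->
  is_derive t 1 (branch u) ((-1) ^+ size u * density u t * (1 + branch u t) / (1 + t)).
Proof.
move=> + t0; elim: u => [|c u IH] /=.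
  move=> _; rewrite !mul1r divff; last by lra.
  exact: is_derive_id.
move=> /andP[c0 /IH {}IH].
have b0 := branch_ge0 u t t0.
have c1 : 1 <= c%:R :> R by rewrite ler1n.
have n0 : c%:R + branch u t != 0 by lra.
have h := is_deriveD (is_derive_cst (c%:R : R) t 1) IH.
have {h} h := @is_deriveV R (cst c%:R + branch u) _ _ _ n0 h.
apply: (is_derive_eq h).
rewrite add0r /GRing.scale /= /cst /digit_prob -natr1 -[_ t]/(c%:R + branch u t) [(-1) ^+ _.+1]exprS.
set z := (-1) ^+ size u; field; lra.
Qed.

Lemma is_derive_primitive u t : posdigits u -> 0 <= t ->
  is_derive t 1 (primitive u) (density u t / (1 + t)).
Proof.
move=> pu t0; have b0 := branch_ge0 u t t0.
have h := is_derive_ln_branch u t pu t0.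
have p0 : 0 < 1 + branch u t by lra.
have h1 := is_deriveD (is_derive_cst (1 : R) t 1) h.
have h2 := @is_derive1_comp R (@ln R) (cst 1 + branch u) t _ _ (is_derive1_ln p0) h1.
have h3 := @is_deriveZ R R^o R^o _ ((-1) ^+ size u) _ _ _ h2.
apply: (is_derive_eq h3).
rewrite add0r /GRing.scale /= -/(1 + branch u t).
have -> : forall z : R, (-1) ^+ size u * (z^-1 * ((-1) ^+ size u * density u t * z / (1 + t))) =
 ((-1) ^+ size u * (-1) ^+ size u) * (z^-1 * z) * density u t / (1 + t) by move=> z; ring.
by rewrite -expr2 sqrr_sign mulVf ?lt0r_neq0 // !mul1r.
Qed.

(** Differentiating termwise gives the assumed nonnegative combination divided by [1 + t].
    [loglen_sum_ge0] then transports this through a branch. *)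
Lemma primitive_sum_le (I : Type) (r : seq I) (k : I -> R) (w : I -> seq nat) (a b : R) :
  all (fun i => posdigits (w i)) r ->
  (forall t, 0 <= t <= 1 -> 0 <= \sum_(i <- r) k i * density (w i) t) ->
  0 <= a -> a <= b -> b <= 1 ->
  \sum_(i <- r) k i * primitive (w i) a <= \sum_(i <- r) k i * primitive (w i) b.
Proof.
move=> pw H a0 ab b1.
have D t : 0 <= t -> is_derive t 1 (fun t => \sum_(i <- r) k i * primitive (w i) t)
    (\sum_(i <- r) k i * (density (w i) t / (1 + t))).
  move=> t0; elim: r pw {H} => [_|i r IH /= /andP[pi /IH {}IH]].
    rewrite big_nil (_ : (fun _ => _) = cst 0); last by apply/funext => z; rewrite big_nil.
    exact: is_derive_cst.
  rewrite big_cons; under eq_fun do rewrite big_cons.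
  apply: is_deriveD; apply: is_deriveZ; exact: is_derive_primitive.
have D' t : t \in `]a, b[ -> derivable (fun t => \sum_(i <- r) k i * primitive (w i) t) t 1.
  by rewrite in_itv /= => /andP[at_ tb]; have [] := D t; first lra.
apply: (@ger0_derive1_le_cc R (fun t => \sum_(i <- r) k i * primitive (w i) t) a b) => //; rewrite ?in_itv /= ?lexx ?ab //.
- move=> t; rewrite in_itv /= => /andP[at_ tb].
  have t0 : 0 <= t by lra.
  rewrite derive1E (@derive_val _ _ _ _ _ _ _ (D t t0)).
  under eq_bigr do rewrite mulrA.
  rewrite -mulr_suml divr_ge0 ?H //; lra.
- apply: derivable_within_continuous => t; rewrite in_itv /= => /andP[at_ tb].
  by have [] := D t; first lra.
Qed.

Lemma primitive_cat u v t :
  primitive (u ++ v) t = (-1) ^+ size v * primitive u (branch v t).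
Proof. by rewrite /primitive branch_cat size_cat exprD mulrCA mulrA. Qed.

Lemma branch_monotone v : posdigits v ->
  0 < (-1) ^+ size v * (branch v 1 - branch v 0).
Proof.
elim: v => [|c v IH] /=; first by rewrite mul1r subr0 ltr01.
move=> /andP[c0 /IH]; have c1 : 1 <= c%:R :> R by rewrite ler1n.
have b0 := branch_ge0 v 0 (lexx 0); have b1 := branch_ge0 v 1 ler01.
set x := branch v 1 in b1 *; set y := branch v 0 in b0 * => H.
have -> : (-1) ^+ (size v).+1 * ((c%:R + x)^-1 - (c%:R + y)^-1) =
   ((-1) ^+ size v * (x - y)) / ((c%:R + x) * (c%:R + y)).
  by rewrite exprS; field; lra.
by rewrite divr_gt0 // mulr_gt0; lra.
Qed.

(* A pointwise inequality between densities integrates to one between cylinder measures. *)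
Lemma loglen_sum_ge0 (I : Type) (r : seq I) (k : I -> R) (w : I -> seq nat) v :
  all (fun i => posdigits (w i)) r -> posdigits v ->
  (forall t, 0 <= t <= 1 -> 0 <= \sum_(i <- r) k i * density (w i) t) ->
  0 <= \sum_(i <- r) k i * loglen (w i ++ v).
Proof.
move=> pw pv H.
under eq_bigr do rewrite /loglen !primitive_cat -mulrBr mulrCA.
rewrite -mulr_sumr; under eq_bigr do rewrite mulrBr.
rewrite sumrB.
have /andP[b10 b11] : 0 <= branch v 1 <= 1 by apply: branch_le1; rewrite ?ler01 ?lexx.
have /andP[b00 b01] : 0 <= branch v 0 <= 1 by apply: branch_le1; rewrite ?ler01 ?lexx.
have := branch_monotone v pv.
(* The parity of [size v] decides which of [branch v 0] and [branch v 1] is the left endpoint. *)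
rewrite -signr_odd; case: (odd _); rewrite ?expr1 ?expr0 ?mul1r ?mulN1r.
  by rewrite !opprB subr_gt0 subr_ge0 => /ltW ?; apply: primitive_sum_le.
by rewrite subr_gt0 subr_ge0 => /ltW ?; apply: primitive_sum_le.
Qed.

Lemma loglen_nil : loglen [::] = ln 2.
Proof. by rewrite /loglen /primitive /= !expr0 !mul1r addr0 ln1 subr0. Qed.

End InverseBranches.

(** * Gauss measure of cylinders *)

Section CylinderMeasure.
Variable R : realType.
Implicit Types (u v w b : seq nat) (t x : R).

Lemma trunc_floor_inv (c : nat) (x : R) : (0 < c)%N -> 0 <= x < 1 ->
  Num.truncn (c%:R + x) = c /\ Num.floor (c%:R + x) = c :> int.
Proof.
move=> c0 /andP[x0 x1]; split.
  by apply: truncn_def; rewrite -natr1; lra.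
by apply: floor_def; rewrite intrD -!pmulrn; lra.
Qed.

Lemma branch_lt1 b t : posdigits b -> 0 < t < 1 -> 0 < branch R b t < 1.
Proof.
move=> + t01; elim: b => [|c b IH] //= /andP[c0 /IH /andP[b0 b1]].
have c1 : 1 <= c%:R :> R by rewrite ler1n.
by rewrite invr_gt0 invf_lt1; lra.
Qed.

(** The parameter stays in the open interval because at [0] or [1] the digits of the image can
    differ from [b]: for [b = [:: c]] and [t = 1] the first digit is [c.+1]. *)
Lemma branch_in_cylinder b t : posdigits b -> 0 < t < 1 ->
  cf_cylinder b (branch R b t).
Proof.
move=> pb t01; split; first by have /andP[? ?] := branch_lt1 b t pb t01; lra.
elim: b pb => [|c b IH] //= /andP[c0 pb] [_|j].
  have /andP[? ?] := branch_lt1 b t pb t01.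
  by rewrite /cf_digit /= invrK; apply: (trunc_floor_inv _ _ _ _).1 => //; lra.
rewrite ltnS => jb; rewrite [RHS]/= -(IH pb j jb) /cf_digit iterSr.
suff -> : gauss_map (c%:R + branch R b t)^-1 = branch R b t by [].
have /andP[? ?] := branch_lt1 b t pb t01.
rewrite /gauss_map invrK (trunc_floor_inv _ _ _ _).2 //; last lra.
rewrite -pmulrn; lra.
Qed.

Lemma cylinder_in_branch b x : posdigits b -> cf_cylinder b x ->
  exists2 t, 0 <= t <= 1 & x = branch R b t.
Proof.
elim: b x => [|c b IH] x /=; first by move=> _ [x01 _]; exists x.
move=> /andP[c0 pb] [/andP[x0 x1] H].
have /= := H 0%N isT; rewrite /cf_digit /= => Hc.
have xi0 : 0 <= x^-1 by rewrite invr_ge0.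
have := truncn_itv xi0; rewrite Hc -natr1 => /andP[cx xc].
have c1 : 1 <= c%:R :> R by rewrite ler1n.
have g : gauss_map x = x^-1 - c%:R.
  rewrite /gauss_map (_ : Num.floor x^-1 = c) ?pmulrn //.
  by apply: floor_def; rewrite intrD -!pmulrn; lra.
have [|t t01 xt] := IH (gauss_map x) pb.
  split; first by rewrite g; lra.
  move=> j jb; have := H j.+1 jb.
  by rewrite /cf_digit iterSr.
by exists t => //; rewrite -xt g addrC subrK invrK.
Qed.

(** A nonnegative product places the point between the two endpoints, whichever of them is the
    smaller. *)
Lemma branch_between b t : posdigits b -> 0 <= t <= 1 ->
  0 <= (branch R b t - branch R b 0) * (branch R b 1 - branch R b t).
Proof.
move=> + t01; elim: b => [|c b IH] /=.
  by move=> _; rewrite subr0; apply: mulr_ge0; lra.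
move=> /andP[c0 /IH]; have c1 : 1 <= c%:R :> R by rewrite ler1n.
have b0 := branch_ge0 R b 0 (lexx 0); have b1 := branch_ge0 R b 1 ler01.
have bt : 0 <= branch R b t by apply: branch_ge0; lra.
set y := branch R b 0 in b0 *; set z := branch R b 1 in b1 *.
set x := branch R b t in bt *.
have -> : ((c%:R + x)^-1 - (c%:R + y)^-1) * ((c%:R + z)^-1 - (c%:R + x)^-1) =
  ((x - y) * (z - x)) / ((c%:R + x) ^+ 2 * (c%:R + y) * (c%:R + z)).
  field; lra.
by move=> H; rewrite divr_ge0 // !mulr_ge0 ?exprn_ge0 //; lra.
Qed.

Lemma branch_onto b x : posdigits b -> 0 < x ->
  0 < (x - branch R b 0) * (branch R b 1 - x) ->
  exists2 t, 0 < t < 1 & x = branch R b t.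
Proof.
elim: b x => [|c b IH] x /=.
  by move=> _ x0; rewrite subr0 pmulr_rgt0 // => ?; exists x => //; lra.
move=> /andP[c0 pb] x0; have c1 : 1 <= c%:R :> R by rewrite ler1n.
have b0 := branch_ge0 R b 0 (lexx 0); have b1 := branch_ge0 R b 1 ler01.
have {}IH := IH (x^-1 - c%:R) pb.
set y := branch R b 0 in b0 IH *; set z := branch R b 1 in b1 IH *.
have -> : (x - (c%:R + y)^-1) * ((c%:R + z)^-1 - x) =
  (((x^-1 - c%:R) - y) * (z - (x^-1 - c%:R))) * (x ^+ 2 / ((c%:R + y) * (c%:R + z))).
  field; lra.
rewrite pmulr_lgt0; last by rewrite divr_gt0 ?exprn_gt0 ?mulr_gt0 //; lra.
move=> H.
have [|//|t t01 xt] := IH.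
  (* A nonpositive [x^-1 - c] is not above [y] or [z], both nonnegative, which would make the
     product nonpositive. *)
  rewrite ltNge; apply/negP => le0.
  have : (x^-1 - c%:R - y) * (z - (x^-1 - c%:R)) <= 0.
    by apply: mulr_le0_ge0; lra.
  lra.
by exists t => //; rewrite -xt addrC subrK invrK.
Qed.

Definition gauss_density t : R := (1 + t)^-1 / ln 2.

Lemma ln2_gt0 : 0 < ln 2 :> R. Proof. by apply: ln_gt0; lra. Qed.

Lemma gauss_density_continuous (a c : R) : 0 <= a ->
  {within `[a, c], continuous gauss_density}.
Proof.
move=> a0; apply: derivable_within_continuous => t; rewrite in_itv /= => /andP[at_ _].
have h := is_deriveD (is_derive_cst (1 : R) t 1) (is_derive_id t 1).
have n0 : (cst (1:R) + id) t != 0 by rewrite lt0r_neq0 // /cst /=; apply: ltr_wpDr => //; lra.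
have h2 := @is_deriveV R (cst (1:R) + id) _ _ _ n0 h.
rewrite (_ : gauss_density = ((ln 2)^-1 \*: (fun y => ((cst (1:R) + id) y)^-1 : R^o))); last first.
  by apply/funext => z; rewrite /gauss_density mulrC.
by apply: derivableZ; case: h2.
Qed.

Lemma gauss_measure_itv (a c : R) : 0 <= a -> a < c ->
  (\int[@lebesgue_measure R]_(u in `[a, c]) (gauss_density u)%:E)%E =
  ((ln (1 + c) - ln (1 + a)) / ln 2)%:E.
Proof.
move=> a0 ac.
pose F t : R := (ln (1 + t)) / ln 2.
have D t : 0 <= t -> is_derive t 1 F (gauss_density t).
  move=> t0; have h := is_deriveD (is_derive_cst (1 : R) t 1) (is_derive_id t 1).
  have p0 : 0 < (cst (1:R) + id) t by rewrite /cst /=; apply: ltr_wpDr => //; lra.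
  have h2 := @is_derive1_comp R (@ln R) (cst (1:R) + id) t _ _ (is_derive1_ln p0) h.
  have h3 := @is_deriveZ R R^o R^o _ ((ln 2)^-1) _ _ _ h2.
  rewrite (_ : F = ((ln 2)^-1 \*: (@ln R \o (cst (1:R) + id) : R -> R^o))); last first.
    by apply/funext => z; rewrite /F mulrC.
  apply: (is_derive_eq h3).
  by rewrite /GRing.scale /= add0r mulr1 mulrC.
rewrite (@continuous_FTC2 R gauss_density F) //; first by rewrite -EFinB /F mulrBl.
- exact: gauss_density_continuous.
- have cF t : 0 <= t -> {for t, continuous F}.
    by move=> t0; apply/differentiable_continuous/derivable1_diffP; case: (D t t0).
  split.
  + by move=> t; rewrite in_itv /= => /andP[? ?]; case: (D t _) => //; lra.
  + by apply: cvg_at_right_filter; apply: cF.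
  + by apply: cvg_at_left_filter; apply: cF; lra.
- move=> t; rewrite in_itv /= => /andP[? ?].
  by rewrite derive1E (@derive_val _ _ _ _ _ _ _ (D t _)) //; lra.
Qed.

(** [A] differs from the closed interval by at most two points, hence is measurable, and its
    integral is squeezed between those over the open and the closed interval. *)
Lemma gauss_measure_between (a c : R) (A : set R) : 0 <= a -> a < c ->
  `]a, c[ `<=` A -> A `<=` `[a, c] ->
  gauss_measure A = ((ln (1 + c) - ln (1 + a)) / ln 2)%:E.
Proof.
move=> a0 ac A1 A2.
have mA : measurable (A : set R).
  have -> : A = `]a, c[ `|` (A `&` [set a; c]).
    apply/seteqP; split=> [z Az|z [/A1//|[]//]].
    have := A2 _ Az; rewrite /= in_itv /= => /andP[za zc].
    have [?|za'] := eqVneq z a; first by right; split => //; left.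
    have [?|zc'] := eqVneq z c; first by right; split => //; right.
    left; rewrite /= in_itv /= !lt_neqAle za zc zc' eq_sym za' //.
  apply: measurableU; first exact: measurable_itv.
  apply: countable_measurable; first exact: measurable_set1.
  apply: (sub_countable _ (_ : countable [set a; c])).
    by apply: subset_card_le; apply: subIsetr.
  by apply: finite_set_countable; exact: finite_set2.
have mf : measurable_fun (`[a, c]%classic : set R) (fun z : R => (gauss_density z)%:E).
  apply/measurable_EFinP.
  apply: subspace_continuous_measurable_fun; first exact: measurable_itv.
  exact: gauss_density_continuous.
have f0 z : `[a, c]%classic z -> (0 <= (gauss_density z)%:E)%E.
  rewrite /= in_itv /= lee_fin => /andP[za zc].
  by rewrite divr_ge0 ?invr_ge0 ?(ltW ln2_gt0) //; lra.
have mfA B : measurable (B : set R) -> B `<=` `[a, c] ->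
   measurable_fun B (fun z : R => (gauss_density z)%:E).
  by move=> mB BA; apply: measurable_funS mf => //; exact: measurable_itv.
rewrite -(gauss_measure_itv a c a0 ac); apply/eqP; rewrite eq_le; apply/andP; split.
  exact: ge0_subset_integral.
rewrite integral_itv_bndoo; last first.
  by apply: mfA; [exact: measurable_itv|move=> z /A1/A2].
apply: ge0_subset_integral => //.
  exact: mfA.
by move=> z /A2; apply: f0.
Qed.

Definition cylprob b : R := loglen R b / ln 2.

(** The cylinder lies between the open and the closed interval with endpoints [branch b 0] and
    [branch b 1], ordered according to the parity of the length of [b]. *)
Lemma gauss_measure_cylinder b : posdigits b ->
  fine (gauss_measure (@cf_cylinder R b)) = cylprob b.
Proof.
move=> pb; have mono := branch_monotone R b pb.
have b0 := branch_ge0 R b 0 (lexx 0); have b1 := branch_ge0 R b 1 ler01.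
have inside x : 0 < x -> 0 < (x - branch R b 0) * (branch R b 1 - x) -> cf_cylinder b x.
  by move=> x0 h; have [t t01 ->] := branch_onto b x pb x0 h; apply: branch_in_cylinder.
have outside x : cf_cylinder b x -> 0 <= (x - branch R b 0) * (branch R b 1 - x).
  by move=> h; have [t t01 ->] := cylinder_in_branch b x pb h; apply: branch_between.
move: mono; rewrite /cylprob /loglen /primitive -signr_odd.
case: (odd _); rewrite ?expr1 ?expr0 ?mul1r ?mulN1r => mono.
  rewrite (@gauss_measure_between (branch R b 1) (branch R b 0)) //= ?mulN1r; last 3 first.
  - lra.
  - move=> x; rewrite /= in_itv /= => /andP[xa xb]; apply: inside; first lra.
    by rewrite -mulrNN !opprB mulr_gt0; lra.
  - move=> x /outside; rewrite -mulrNN !opprB /= in_itv /= => H.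
    by apply/andP; split; rewrite leNgt; apply/negP => lt;
      [have : (branch R b 0 - x) * (x - branch R b 1) < 0 by rewrite pmulr_rlt0; lra
      |have : (branch R b 0 - x) * (x - branch R b 1) < 0 by rewrite nmulr_rlt0; lra]; lra.
  by rewrite opprK addrC.
rewrite (@gauss_measure_between (branch R b 0) (branch R b 1)) //=; last 3 first.
- lra.
- move=> x; rewrite /= in_itv /= => /andP[xa xb]; apply: inside; first lra.
  by rewrite mulr_gt0; lra.
- move=> x /outside; rewrite /= in_itv /= => H.
  by apply/andP; split; rewrite leNgt; apply/negP => lt;
    [have : (x - branch R b 0) * (branch R b 1 - x) < 0 by rewrite nmulr_rlt0; lra
    |have : (x - branch R b 0) * (branch R b 1 - x) < 0 by rewrite pmulr_rlt0; lra]; lra.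
Qed.

End CylinderMeasure.

(** * Transfer operator and mixing *)

Section TransferOperator.
Variable R : realType.
Implicit Types (u v w c : seq nat) (t x y : R) (f : R -> R) (M g n : nat).

(** The alphabet is cut at [M] so that sums over words are finite; the lost mass is estimated
    separately. *)
Fixpoint words M g : seq (seq nat) :=
  if g is g'.+1 then [seq n.+1 :: u | n <- iota 0 M, u <- words M g'] else [:: [::]].

Lemma big_words M g (F : seq nat -> R) :
  \sum_(c <- words M g.+1) F c = \sum_(0 <= n < M) \sum_(c <- words M g) F (n.+1 :: c).
Proof. by rewrite /= big_allpairs_dep /index_iota subn0. Qed.

Lemma words_pos M g : all posdigits (words M g).
Proof.
elim: g => //= g IH; apply/allP => _ /allpairsP[[n u] /= [_ ug ->]] /=.
exact: (allP IH).
Qed.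

Lemma words_size M g c : c \in words M g -> size c = g.
Proof.
elim: g c => [|g IH] c /=; first by rewrite inE => /eqP->.
by move=> /allpairsP[[n u] /= [_ /IH ug ->]] /=; rewrite ug.
Qed.

Lemma words_uniq M g : uniq (words M g).
Proof.
elim: g => //= g IH; apply: allpairs_uniq => //; first exact: iota_uniq.
by move=> [n u] [n' u'] _ _ /= [-> ->].
Qed.

(** The Gauss-Kuzmin operator conjugated by the Gauss density, restricted to digits at most [M]. *)
Definition transfer M f t : R :=
  \sum_(0 <= n < M) digit_prob R n.+1 t * f ((n.+1%:R + t)^-1).

(** Summing over the first digit of the word applies [transfer] to [f]; the remaining digits are
    handled by induction. *)
Lemma sum_density_words M g f t :
  \sum_(c <- words M g) density R c t * f (branch R c t) = iter g (transfer M) f t.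
Proof.
elim: g f => [|g IH] f; first by rewrite big_seq1 mul1r.
rewrite iterSr -IH big_words exchange_big /=; apply: eq_bigr => u _.
by rewrite /transfer mulr_sumr; apply: eq_bigr => n _; rewrite mulrCA mulrA.
Qed.

(** The sum telescopes; the missing mass is the conditional probability of a digit above [M]. *)
Lemma sum_digit_prob M t : 0 <= t ->
  \sum_(0 <= n < M) digit_prob R n.+1 t = 1 - (1 + t) / (M.+1%:R + t).
Proof.
move=> t0; elim: M => [|M IH]; first by rewrite big_geq // divff ?subrr //; lra.
rewrite big_nat_recr //= IH /digit_prob -!natr1.
have : 0 <= M%:R :> R by []; move: (M%:R) => z z0; field; lra.
Qed.

Lemma inv_digit_itv n t : 0 <= t -> 0 <= (n.+1%:R + t)^-1 <= 1.
Proof.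
move=> t0; have n0 : 1 <= n.+1%:R :> R by rewrite ler1n.
by rewrite invr_ge0 invf_le1; lra.
Qed.

Lemma digit_prob_ge0 n t : 0 <= t -> 0 <= digit_prob R n.+1 t.
Proof. by move=> t0; apply/ltW/digit_prob_gt0. Qed.

Lemma transfer_le M f1 f2 t : (forall x, 0 <= x <= 1 -> f1 x <= f2 x) -> 0 <= t <= 1 ->
  transfer M f1 t <= transfer M f2 t.
Proof.
move=> H t01; apply: ler_sum => n _; apply: ler_wpM2l; first by apply: digit_prob_ge0; lra.
by apply: H; apply: inv_digit_itv; lra.
Qed.

(* Sending the digits [> M] to the point [0] keeps the operator Markov and the sums finite. *)
Definition markov M f t : R := transfer M f t + (1 + t) / (M.+1%:R + t) * f 0.

Lemma markovE M f t : 0 <= t ->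
  markov M f t = f 0 + \sum_(0 <= n < M) digit_prob R n.+1 t * (f ((n.+1%:R + t)^-1) - f 0).
Proof.
move=> t0; rewrite /markov /transfer.
under [in RHS]eq_bigr do rewrite mulrBr.
rewrite sumrB -mulr_suml sum_digit_prob //; ring.
Qed.

Definition nondecr01 f := forall x y, 0 <= x -> x <= y -> y <= 1 -> f x <= f y.

(** Summation by parts, through the stronger lower bound by [h M] times the full sum of [d], which
    survives the induction. *)
Lemma abel_ge0 M (d h : nat -> R) :
  (forall n, (n <= M)%N -> 0 <= \sum_(0 <= i < n) d i) ->
  (forall n, 0 <= h n) -> (forall n, h n.+1 <= h n) ->
  0 <= \sum_(0 <= i < M) d i * h i.
Proof.
move=> D h0 hd.
suff : h M * \sum_(0 <= i < M) d i <= \sum_(0 <= i < M) d i * h i.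
  by apply: le_trans; rewrite mulr_ge0 ?D.
elim: M D => [|M IH] D; first by rewrite !big_geq // mulr0.
apply: (@le_trans _ _ (h M * \sum_(0 <= i < M.+1) d i)).
  by rewrite ler_wpM2r // D.
rewrite !big_nat_recr //= mulrDr mulrC [h M * d M]mulrC lerD2r mulrC.
by apply: IH => n nM; apply: D; rewrite (leq_trans nM).
Qed.

(** As [t] grows, each point [1 / (n + t)] moves left and the digit law shifts towards larger
    digits, whose points are further left; both effects lower the mean of [f]. *)
Lemma markov_monotone M f : nondecr01 f -> nondecr01 (fun t => - markov M f t).
Proof.
move=> mf x y x0 xy y1; rewrite lerN2 !markovE //; last lra.
rewrite lerD2l.
have f0 n t : 0 <= t -> 0 <= f ((n.+1%:R + t)^-1) - f 0.
  by move=> t0; rewrite subr_ge0; have /andP[? ?] := inv_digit_itv n t t0; apply: mf.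
have n1 n : 1 <= n.+1%:R :> R by rewrite ler1n.
(* First the weights change with the points held at [y], which is where [abel_ge0] is used; then the
   points move. *)
apply: (@le_trans _ _ (\sum_(0 <= n < M) digit_prob R n.+1 x * (f ((n.+1%:R + y)^-1) - f 0))).
  rewrite -subr_ge0 -sumrB; under eq_bigr do rewrite -mulrBl.
  apply: (abel_ge0 M (fun n => digit_prob R n.+1 x - digit_prob R n.+1 y)
            (fun n => f ((n.+1%:R + y)^-1) - f 0)) => [n _|n|n].
  - rewrite sumrB !sum_digit_prob //; last lra.
    have := n1 n; set z := n.+1%:R => z1.
    have -> : 1 - (1 + x) / (z + x) - (1 - (1 + y) / (z + y)) =
      (z - 1) * (y - x) / ((z + x) * (z + y)) by field; lra.
    by rewrite divr_ge0 // mulr_ge0; lra.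
  - by apply: f0; lra.
  - rewrite lerD2r.
    have /andP[? _] := inv_digit_itv n.+1 y ltac:(lra).
    have /andP[_ ?] := inv_digit_itv n y ltac:(lra).
    apply: mf => //; rewrite lef_pV2 ?posrE; [|have := n1 n; lra..].
    by rewrite -[in leRHS]natr1; lra.
apply: ler_sum => n _; apply: ler_wpM2l; first exact: digit_prob_ge0.
rewrite lerD2r.
have /andP[? _] := inv_digit_itv n y ltac:(lra).
have /andP[_ ?] := inv_digit_itv n x ltac:(lra).
by apply: mf => //; rewrite lef_pV2 ?posrE; have := n1 n; lra.
Qed.

(** The weight of the digit [i + 2] at [0] is [a (i + 1)], while at [1] the digit [i + 1] has weight
    [2 * a (i + 1)] at the same point. After cancellation only the first term counts, and its weight
    [a 0 = 1 / 2] is the contraction factor. *)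
Lemma markov_variation M f : nondecr01 f -> markov M f 0 - markov M f 1 <= (f 1 - f 0) / 2.
Proof.
move=> mf; rewrite !markovE // opprD addrACA subrr add0r -sumrB.
pose h n := f ((n.+1%:R : R)^-1) - f 0.
have h0 n : 0 <= h n.
  rewrite subr_ge0; have /andP[? ?] := inv_digit_itv n 0 (lexx 0).
  by apply: mf => //; rewrite -[n.+1%:R]addr0.
pose a n : R := (n.+1%:R * n.+2%:R)^-1.
have a0 n : 0 <= a n by rewrite invr_ge0 mulr_ge0.
have -> : \sum_(0 <= i < M) (digit_prob R i.+1 0 * (f (i.+1%:R + 0)^-1 - f 0)
     - digit_prob R i.+1 1 * (f (i.+1%:R + 1)^-1 - f 0)) =
   \sum_(0 <= i < M) (a i * h i - 2 * a i.+1 * h i.+1).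
  apply: eq_bigr => i _; congr (_ - _).
    by rewrite /digit_prob /a /h !addr0 mul1r.
  by rewrite /digit_prob /a /h !natr1 // .
(* The term [a M * h M] is kept so that the induction telescopes. *)
suff : \sum_(0 <= i < M) (a i * h i - 2 * a i.+1 * h i.+1) <= h 0%N / 2 - a M * h M.
  move/le_trans; apply; rewrite /h invr1.
  have := mulr_ge0 (a0 M) (h0 M); rewrite /h; lra.
elim: M => [|M IH]; first by rewrite big_geq // /a mulr_natr; lra.
rewrite big_nat_recr //=; move: IH.
have := mulr_ge0 (a0 M.+1) (h0 M.+1); lra.
Qed.

(** Bounded variation encoded by a Jordan decomposition, since [markov] is controlled on monotone
    functions. *)
Definition variation_le f (V : R) := exists f1 f2, [/\ nondecr01 f1, nondecr01 f2,
  forall t, 0 <= t <= 1 -> f t = f1 t - f2 t & f1 1 - f1 0 + (f2 1 - f2 0) <= V].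

Lemma variation_le_osc f V x y : variation_le f V -> 0 <= x <= 1 -> 0 <= y <= 1 ->
  f x <= f y + V.
Proof.
move=> [f1 [f2 [m1 m2 E]]] + x01 y01; rewrite !E //.
have /andP[x0 x1] := x01; have /andP[y0 y1] := y01.
have := m1 0 y (lexx 0) y0 y1; have := m1 x 1 x0 x1 (lexx 1).
have := m2 0 x (lexx 0) x0 x1; have := m2 y 1 y0 y1 (lexx 1); lra.
Qed.

(** Since [markov] reverses monotonicity, the two parts of the decomposition exchange their
    roles. *)
Lemma variation_le_markov M f V : variation_le f V -> variation_le (markov M f) (V / 2).
Proof.
move=> [f1 [f2 [m1 m2 E VE]]].
exists (fun t => - markov M f2 t), (fun t => - markov M f1 t); split.
- exact: markov_monotone.
- exact: markov_monotone.
- move=> t t01; rewrite opprK addrC /markov /transfer (E 0) ?lexx ?ler01 //.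
  rewrite opprD addrACA -mulrBr -sumrB; congr (_ + _); apply: eq_bigr => n _.
  by rewrite -mulrBr E //; apply: inv_digit_itv; lra.
- have := markov_variation M f1 m1; have := markov_variation M f2 m2; lra.
Qed.

Lemma variation_le_iter_markov M g f V :
  variation_le f V -> variation_le (iter g (markov M) f) (V / 2 ^+ g).
Proof.
move=> fV; elim: g => [|g IH]; first by rewrite expr0 divr1.
by rewrite iterS exprSr invfM mulrA; apply: variation_le_markov.
Qed.

Lemma tail_prob_le M t : 0 <= t <= 1 -> 0 <= (1 + t) / (M.+1%:R + t) <= 2 / M.+1%:R.
Proof.
move=> t01; have n1 : 1 <= M.+1%:R :> R by rewrite ler1n.
rewrite divr_ge0; [|lra..]; rewrite /= ler_pdivrMr; last lra.
rewrite mulrDr divfK; last lra.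
have : 0 <= 2 / M.+1%:R * t by rewrite mulr_ge0 ?divr_ge0 //; lra.
move: (_ * t) => z; lra.
Qed.

Lemma markov_le M f B : (forall t, 0 <= t <= 1 -> 0 <= f t <= B) ->
  forall t, 0 <= t <= 1 -> 0 <= markov M f t <= B.
Proof.
move=> H t t01; have /andP[tl _] := tail_prob_le M t t01.
have H0 := H 0 ltac:(by rewrite lexx ler01).
have Hi n := H _ (inv_digit_itv n t ltac:(lra)).
apply/andP; split.
  apply: addr_ge0; last by apply: mulr_ge0 => //; lra.
  by apply: sumr_ge0 => n _; have /andP[? ?] := Hi n; rewrite mulr_ge0 ?digit_prob_ge0 //; lra.
apply: (@le_trans _ _ (\sum_(0 <= n < M) digit_prob R n.+1 t * B + (1 + t) / (M.+1%:R + t) * B)).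
  rewrite /markov /transfer; apply: lerD; last by rewrite ler_wpM2l //; lra.
  apply: ler_sum => n _; rewrite ler_wpM2l //; last by have := Hi n; lra.
  by rewrite digit_prob_ge0; lra.
by rewrite -mulr_suml sum_digit_prob; lra.
Qed.

Lemma iter_markov_le M g f B : (forall t, 0 <= t <= 1 -> 0 <= f t <= B) ->
  forall t, 0 <= t <= 1 -> 0 <= iter g (markov M) f t <= B.
Proof. by move=> H; elim: g => // g IH; apply: markov_le. Qed.

Lemma iter_transfer_le_markov M g f B : (forall t, 0 <= t <= 1 -> 0 <= f t <= B) ->
  forall t, 0 <= t <= 1 -> iter g (transfer M) f t <= iter g (markov M) f t.
Proof.
move=> H; elim: g => // g IH t t01; rewrite !iterS /markov -/(markov M).
apply: (le_trans (transfer_le _ _ _ _ IH t01)).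
have /andP[? _] := tail_prob_le M t t01.
have := iter_markov_le M g f B H 0 ltac:(by rewrite lexx ler01).
by move=> /andP[? ?]; rewrite lerDl mulr_ge0.
Qed.

(** Each of the [g] steps drops a tail term of weight at most [2 / M.+1] applied to a value at most
    [B]. *)
Lemma iter_markov_le_transfer M g f B : (forall t, 0 <= t <= 1 -> 0 <= f t <= B) ->
  forall t, 0 <= t <= 1 ->
    iter g (markov M) f t <= iter g (transfer M) f t + g%:R * (2 / M.+1%:R * B).
Proof.
move=> H; elim: g => [|g IH] t t01; first by rewrite mul0r addr0.
have B0 : 0 <= B by have := H 0 ltac:(by rewrite lexx ler01); lra.
set e := 2 / M.+1%:R * B in IH *.
have e0 : 0 <= e by rewrite mulr_ge0 ?divr_ge0.
rewrite !iterS /markov -/(markov M) (_ : g.+1%:R * e = g%:R * e + e); last first.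
  by rewrite -natr1 mulrDl mul1r.
rewrite addrA.
have /andP[tl tu] := tail_prob_le M t t01.
have F0 := iter_markov_le M g f B H 0 ltac:(by rewrite lexx ler01).
apply: lerD; last by apply: ler_pM => //; lra.
apply: (le_trans (transfer_le _ _ _ _ IH t01)).
rewrite /transfer; under eq_bigr do rewrite mulrDr.
rewrite big_split /= lerD2l -mulr_suml sum_digit_prob; last lra.
by rewrite ler_piMl ?mulr_ge0 //; lra.
Qed.

(** The first error vanishes as [g] grows and, for fixed [g], the second as [M] grows: the iterate
    becomes nearly constant. *)
Lemma iter_transfer_osc M g f B V x y : (forall t, 0 <= t <= 1 -> 0 <= f t <= B) ->
  variation_le f V -> 0 <= x <= 1 -> 0 <= y <= 1 ->
  iter g (transfer M) f x <= iter g (transfer M) f y + (V / 2 ^+ g + g%:R * (2 / M.+1%:R * B)).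
Proof.
move=> H fV x01 y01.
have := iter_transfer_le_markov M g f B H x x01.
have := iter_markov_le_transfer M g f B H y y01.
have := variation_le_osc _ _ _ _ (variation_le_iter_markov M g f V fV) x01 y01.
move=> h1 h2 h3; apply: (le_trans h3); apply: (le_trans h1).
by rewrite [V / _ + _]addrC addrA lerD2r.
Qed.

End TransferOperator.

(** * Mixing of the Gauss system, uniformly over cylinders *)

Section Mixing.
Variable R : realType.
Implicit Types (u v w c : seq nat) (t x y : R) (f : R -> R) (M g n : nat).
Local Notation density := (density R).
Local Notation branch := (branch R).
Local Notation loglen := (loglen R).
Local Notation cylprob := (cylprob R).

(** [branch u] is a Moebius map, which explains the two affine denominators. The induction is on the
    last digit, because appending [c] substitutes [1 / (c + t)] for [t] and preserves this form with
    slopes in [[0, 1]]. *)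
Lemma density_form u : posdigits u ->
  exists C a b : R, [/\ 0 < C, 0 <= a <= 1, 0 <= b <= 1 &
    forall t, 0 <= t <= 1 -> density u t = C * (1 + t) / ((1 + a * t) * (1 + b * t))].
Proof.
elim/last_ind: u => [|u c IH].
  exists 1, 1, 0; rewrite !lexx ler01; split => // t t01 /=.
  by rewrite mul0r addr0 mulr1 !mul1r divff //; lra.
rewrite /posdigits all_rcons => /andP[c0 /IH [C [a [b [C0 a01 b01 E]]]]].
have c1 : 1 <= c%:R :> R by rewrite ler1n.
exists (C / ((c%:R + a) * (c%:R + b))), (c%:R + a)^-1, (c%:R + b)^-1.
split; [by rewrite divr_gt0 ?mulr_gt0 //; lra|..].
- by rewrite invr_ge0 invf_le1; lra.
- by rewrite invr_ge0 invf_le1; lra.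
move=> t t01; rewrite -cats1 density_cat /= mulr1 E; last first.
  by rewrite invr_ge0 invf_le1; lra.
by rewrite /digit_prob -natr1; field; lra.
Qed.

(** Used with [p = a * x], [q = a * y], [r = b * x], [s = b * y]: the normalised density of
    [density_form] descends with slope at most [4]. *)
Lemma density_slope (x y p q r s : R) : y <= 1 ->
  p <= q -> r <= s -> q - p <= y - x -> s - r <= y - x ->
  0 <= p <= x -> 0 <= r <= x -> 0 <= q <= y -> 0 <= s <= y ->
  (1 + x) / ((1 + p) * (1 + r)) <= (1 + y) / ((1 + q) * (1 + s)) + 4 * (y - x).
Proof.
move=> y1 pq rs pq' rs' H3 H4 H1 H2.
have P1 : 1 <= (1 + p) * (1 + r) by nra.
have P2 : 1 <= (1 + q) * (1 + s) by nra.
have d : (1 + q) * (1 + s) - (1 + p) * (1 + r) <= 2 * (y - x) * ((1 + p) * (1 + r) * ((1 + q) * (1 + s))).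
  apply: (@le_trans _ _ ((y - x) * (1 + r) + (y - x) * (1 + q))); first nra.
  have h1 : 1 + r <= (1 + p) * (1 + r) * ((1 + q) * (1 + s)).
    have : 1 + r <= (1 + p) * (1 + r) by nra.
    move: P1 P2; move: ((1 + p) * (1 + r)) ((1 + q) * (1 + s)) => z z'; nra.
  have h2 : 1 + q <= (1 + p) * (1 + r) * ((1 + q) * (1 + s)).
    have : 1 + q <= (1 + q) * (1 + s) by nra.
    move: P1 P2; move: ((1 + p) * (1 + r)) ((1 + q) * (1 + s)) => z z'; nra.
  move: h1 h2; move: (_ * _ * (_ * _)) => z; nra.
have ij : ((1 + p) * (1 + r))^-1 - ((1 + q) * (1 + s))^-1 <= 2 * (y - x).
  rewrite (_ : _ - _ = ((1 + q) * (1 + s) - (1 + p) * (1 + r)) / ((1 + p) * (1 + r) * ((1 + q) * (1 + s)))).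
    by rewrite ler_pdivrMr //; apply: mulr_gt0; lra.
  by field; do ?[apply/andP; split]; lra.
have i0 : 0 < ((1 + q) * (1 + s))^-1 by rewrite invr_gt0; lra.
have j0 : 0 < ((1 + p) * (1 + r))^-1 by rewrite invr_gt0; lra.
move: ij i0 j0; move: (((1 + q) * (1 + s))^-1) (((1 + p) * (1 + r))^-1) => i j ij i0 j0.
nra.
Qed.

(** [C] is the value at [0]. The normalised density lies between [1 / (1 + t)] and [1 + t], so all
    densities are regular on the scale of their own size. *)
Lemma density_regular u : posdigits u -> exists C : R,
  [/\ 0 < C, forall t, 0 <= t <= 1 -> C / 2 <= density u t,
    forall t, 0 <= t <= 1 -> 0 <= density u t <= 2 * C & variation_le R (density u) (10 * C)].
Proof.
move=> /density_form [C [a [b [C0 /andP[a0 a1] /andP[b0 b1] E]]]].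
have den t : 0 <= t <= 1 -> 0 <= a * t <= t /\ 0 <= b * t <= t.
  by move=> /andP[t0 t1]; rewrite !mulr_ge0 // !ler_piMl.
have lo t : 0 <= t <= 1 -> C / 2 <= density u t.
  move=> t01; rewrite E //; have [h1 h2] := den t t01.
  rewrite -mulrA ler_wpM2l ?(ltW C0) // ler_pdivlMr; last by rewrite mulr_gt0; lra.
  apply: (@le_trans _ _ (2^-1 * ((1 + t) * (1 + t)))).
    by rewrite ler_wpM2l ?invr_ge0 // ler_pM; lra.
  nra.
have hi t : 0 <= t <= 1 -> 0 <= density u t <= 2 * C.
  move=> t01; have := lo t t01; move=> l; apply/andP; split; first lra.
  rewrite E //; have [h1 h2] := den t t01.
  rewrite ler_pdivrMr; last by rewrite mulr_gt0; lra.
  have : 1 <= (1 + a * t) * (1 + b * t) by rewrite -[leLHS]mulr1 ler_pM; lra.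
  nra.
exists C; split => //.
(* Adding the slope bound of [density_slope] makes the first part nondecreasing. *)
exists (fun t => density u t + 4 * C * t), (fun t => 4 * C * t); split.
- move=> x y x0 xy y1; rewrite !E; [|lra..].
  have x01 : 0 <= x <= 1 by lra.
  have y01 : 0 <= y <= 1 by lra.
  have [] := den x x01; have [] := den y y01.
  have ax : a * x <= a * y by rewrite ler_wpM2l.
  have bx : b * x <= b * y by rewrite ler_wpM2l.
  have ad : a * y - a * x <= y - x by rewrite -mulrBr ler_piMl //; lra.
  have bd : b * y - b * x <= y - x by rewrite -mulrBr ler_piMl //; lra.
  move=> H1 H2 H3 H4.
  have := density_slope x y (a * x) (a * y) (b * x) (b * y) y1 ax bx ad bd H3 H4 H1 H2.
  rewrite -(ler_pM2l C0) mulrDr !mulrA; lra.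
- by move=> x y x0 xy y1; rewrite ler_wpM2l //; lra.
- by move=> t t01; lra.
- have := hi 1 ltac:(by rewrite lexx ler01); have := lo 0 ltac:(by rewrite lexx ler01).
  have : 0 <= C by lra.
  lra.
Qed.

Lemma loglen_scale_le u v (k : R) : posdigits u -> posdigits v ->
  (forall t, 0 <= t <= 1 -> k <= density u t) -> k * loglen v <= loglen (u ++ v).
Proof.
move=> pu pv H.
have := @loglen_sum_ge0 R (R * seq nat) [:: (1, u); (- k, [::])] (fun i => i.1) (fun i => i.2) v.
rewrite /= pu !big_cons big_nil /= addr0 mul1r mulNr subr_ge0; apply => // t t01.
by rewrite !big_cons big_nil /= mul1r mulr1 addr0 subr_ge0 H.
Qed.

Lemma loglen_words_ge (s : seq (seq nat)) v (k : R) : all posdigits s -> posdigits v ->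
  (forall t, 0 <= t <= 1 -> k <= \sum_(c <- s) density c t) ->
  k * loglen v <= \sum_(c <- s) loglen (c ++ v).
Proof.
move=> ps pv H.
have := @loglen_sum_ge0 R (R * seq nat) ((- k, [::]) :: [seq (1, c) | c <- s])
  (fun i => i.1) (fun i => i.2) v.
rewrite /= all_map big_cons big_map /= mulNr.
under eq_bigr do rewrite mul1r.
rewrite addrC subr_ge0; apply => // t t01.
rewrite big_cons big_map /= mulr1; under eq_bigr do rewrite mul1r.
by rewrite addrC subr_ge0 H.
Qed.

Lemma loglen_words_le (s : seq (seq nat)) v (k : R) : all posdigits s -> posdigits v ->
  (forall t, 0 <= t <= 1 -> \sum_(c <- s) density c t <= k) ->
  \sum_(c <- s) loglen (c ++ v) <= k * loglen v.
Proof.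
move=> ps pv H.
have := @loglen_sum_ge0 R (R * seq nat) ((k, [::]) :: [seq (-1, c) | c <- s])
  (fun i => i.1) (fun i => i.2) v.
rewrite /= all_map big_cons big_map /=.
under eq_bigr do rewrite mulN1r.
rewrite sumrN subr_ge0; apply => // t t01.
rewrite big_cons big_map /= mulr1; under eq_bigr do rewrite mulN1r.
by rewrite sumrN subr_ge0 H.
Qed.

Lemma loglen_gt0 u : posdigits u -> 0 < loglen u.
Proof.
move=> pu; have [C [C0 lo _ _]] := density_regular u pu.
have := loglen_scale_le u [::] (C / 2) pu isT lo.
rewrite cats0 loglen_nil; apply: lt_le_trans.
by rewrite mulr_gt0 ?(ln2_gt0 R) // divr_gt0.
Qed.

Lemma cylprob_gt0 u : posdigits u -> 0 < cylprob u.
Proof. by move=> pu; rewrite divr_gt0 ?loglen_gt0 ?(ln2_gt0 R). Qed.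

(** Bounding [C] by the cylinder measure makes the later error terms relative to that measure. *)
Lemma density_le_cylprob u : posdigits u -> exists C : R,
  [/\ 0 < C, forall t, 0 <= t <= 1 -> 0 <= density u t <= 2 * C,
    variation_le R (density u) (10 * C) & C <= 2 * cylprob u].
Proof.
move=> pu; have [C [C0 lo hi va]] := density_regular u pu.
exists C; split => //.
have := loglen_scale_le u [::] (C / 2) pu isT lo.
rewrite cats0 loglen_nil /cylprob mulrA ler_pdivlMr ?(ln2_gt0 R) //.
by move: (ln 2) => z; lra.
Qed.

(** The cylinders extending [u] by one digit are adjacent, so their sum telescopes. The part left
    out is the image of [[0, 1 / M.+1]], estimated through the upper bound on the density. *)
Lemma loglen_next_digit u M : posdigits u ->
  (1 - 4 / ln 2 / M.+1%:R) * loglen u <= \sum_(0 <= n < M) loglen (u ++ [:: n.+1]).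
Proof.
move=> pu; have n1 : 1 <= M.+1%:R :> R by rewrite ler1n.
have -> : \sum_(0 <= n < M) loglen (u ++ [:: n.+1]) =
   primitive R u 1 - primitive R u (M.+1%:R^-1).
  elim: {n1} M => [|M IH]; first by rewrite big_geq // invr1 subrr.
  rewrite big_nat_recr //= IH /loglen !primitive_cat /= expr1 !mulN1r addr0.
  by rewrite natr1; ring.
have [C [C0 hi _ CL]] := density_le_cylprob u pu.
have := @primitive_sum_le R (R * seq nat) [:: (-1, u); (2 * C, [::])] (fun i => i.1) (fun i => i.2) 0 M.+1%:R^-1.
rewrite /= pu !big_cons !big_nil /= !addr0 !mulN1r.
rewrite {2 4}/primitive /= expr0 !mul1r addr0 ln1 mulr0 addr0 => /(_ isT) H.
have {}H : primitive R u (M.+1%:R^-1) - primitive R u 0 <= 2 * C * ln (1 + M.+1%:R^-1).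
  suff : - primitive R u 0 <= - primitive R u M.+1%:R^-1 + 2 * C * ln (1 + M.+1%:R^-1) by lra.
  apply: H; rewrite ?lexx ?invr_ge0 ?invf_le1 //; try lra.
  by move=> t t01; rewrite !big_cons big_nil /= addr0 mulr1 mulN1r; have := hi t t01; lra.
have l1 : ln (1 + M.+1%:R^-1) <= M.+1%:R^-1 :> R.
  have := @le_ln1Dx R M.+1%:R^-1; apply.
  by apply: (@lt_le_trans _ _ 0); rewrite ?invr_ge0 ?ltrN10; lra.
have i0 : 0 < M.+1%:R^-1 :> R by rewrite invr_gt0; lra.
rewrite mulrBl mul1r {1}/loglen.
suff : primitive R u M.+1%:R^-1 - primitive R u 0 <= 4 / ln 2 / M.+1%:R * loglen u.
  by move: (4 / _ / _ * _) => z; lra.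
apply: (le_trans H).
apply: (@le_trans _ _ (2 * C * M.+1%:R^-1)); first by rewrite ler_wpM2l //; lra.
rewrite [leRHS]mulrAC ler_wpM2r ?(ltW i0) //.
rewrite (_ : 4 / ln 2 * loglen u = 2 * (2 * (loglen u / ln 2))); last by ring.
by rewrite ler_wpM2l.
Qed.

Lemma loglen_next_digits u M g : posdigits u -> 4 / ln 2 / M.+1%:R <= 1 :> R ->
  (1 - 4 / ln 2 / M.+1%:R) ^+ g * loglen u <= \sum_(c <- words M g) loglen (u ++ c).
Proof.
move=> + K; elim: g u => [|g IH] u pu.
  by rewrite expr0 mul1r big_seq1 cats0.
rewrite big_words exprSr -mulrA.
apply: (@le_trans _ _ ((1 - 4 / ln 2 / M.+1%:R) ^+ g * \sum_(0 <= n < M) loglen (u ++ [:: n.+1]))).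
  by rewrite ler_wpM2l ?loglen_next_digit // exprn_ge0 // subr_ge0.
rewrite mulr_sumr; apply: ler_sum => n _.
apply: (le_trans (IH _ _)); first by rewrite posdigits_cat pu.
by apply: ler_sum => c _; rewrite -catA.
Qed.

Lemma bernoulli_ge (x : R) g : 0 <= x <= 1 -> 1 - g%:R * x <= (1 - x) ^+ g.
Proof.
move=> x01; elim: g => [|g IH]; first by rewrite mul0r subr0.
rewrite exprS -natr1; apply: (@le_trans _ _ ((1 - x) * (1 - g%:R * x))).
  have : 0 <= g%:R * x * x by rewrite !mulr_ge0 //; lra.
  by move: (g%:R) => z; nra.
by rewrite ler_wpM2l //; lra.
Qed.

Lemma small_inv_nat (K e : R) : 0 <= K -> 0 < e -> exists M, forall N, (M <= N)%N -> K / N.+1%:R <= e.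
Proof.
move=> K0 e0; exists (Num.truncn (K / e)) => N MN.
rewrite ler_pdivrMr // mulrC -ler_pdivrMr //.
apply/ltW/(lt_le_trans (truncnS_gt _)).
by rewrite ler_nat ltnS.
Qed.

(** Tightness: it allows sums over the infinitely many words of length [L] to be replaced by finite
    ones. *)
Lemma words_tight L (e : R) : 0 < e -> exists M, 1 - e <= \sum_(c <- words M L) cylprob c.
Proof.
move=> e0; have K0 : 0 <= 4 / ln 2 :> R by rewrite divr_ge0 // ltW ?(ln2_gt0 R).
have [M1 H1] := small_inv_nat (4 / ln 2) 1 K0 ltr01.
have [M2 H2] := small_inv_nat (L%:R * (4 / ln 2)) e (mulr_ge0 (ler0n _ _) K0) e0.
exists (maxn M1 M2).
have {}H1 := H1 _ (leq_maxl M1 M2); have {}H2 := H2 _ (leq_maxr M1 M2).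
have := loglen_next_digits [::] (maxn M1 M2) L isT H1.
rewrite loglen_nil -ler_pdivlMr ?(ln2_gt0 R) // mulr_suml; apply: le_trans.
apply: le_trans (bernoulli_ge _ _ _); last by rewrite divr_ge0.
by rewrite mulrA lerD2l lerN2.
Qed.

(** [g] and [M] do not depend on the cylinders. Summed over the words in between, the densities form
    [iter g (transfer M)] of [density u], nearly constant relative to [cylprob u]; the resulting
    pointwise lower bound is integrated over the cylinder of [w]. *)
Lemma gauss_mixing (e : R) : 0 < e -> exists g M, forall u w,
  posdigits u -> posdigits w ->
  (1 - e) * cylprob u * cylprob w <= \sum_(c <- words M g) cylprob (u ++ c ++ w).
Proof.
move=> e0; have K0 : 0 <= 4 / ln 2 :> R by rewrite divr_ge0 // ltW ?(ln2_gt0 R).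
have e2 : 0 < e / 2 by lra.
have e4 : 0 < e / 4 by lra.
(* As [2 ^ g > g], [20 / 2 ^ g <= 20 / g.+1]; [20] is the variation constant [10] times the factor
   [2] in [C <= 2 * cylprob u]. *)
have [g Hg] := small_inv_nat 20 (e / 2) ltac:(lra) e2.
have {Hg} Hg : 20 / 2 ^+ g <= e / 2.
  apply: le_trans (Hg g (leqnn g)); rewrite ler_wpM2l // lef_pV2 ?posrE ?exprn_gt0 //.
  by rewrite -natrX ler_nat ltn_expl.
(* The three thresholds serve to keep the retained fraction nonnegative, to bound the mass lost to
   large digits in [g] steps, and to bound the truncation error of [transfer]. *)
have [M1 H1] := small_inv_nat (4 / ln 2) 1 K0 ltr01.
have [M2 H2] := small_inv_nat (g%:R * (4 / ln 2)) (e / 4) (mulr_ge0 (ler0n _ _) K0) e4.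
have [M3 H3] := small_inv_nat (g%:R * 8) (e / 4) (mulr_ge0 (ler0n _ _) (ler0n _ 8)) e4.
pose M := maxn M1 (maxn M2 M3).
have {}H1 := H1 M (leq_maxl _ _).
have {}H2 := H2 M (leq_trans (leq_maxl _ _) (leq_maxr _ _)).
have {}H3 := H3 M (leq_trans (leq_maxr _ _) (leq_maxr _ _)).
exists g, M => u w pu pw.
have [C [C0 hi va CL]] := density_le_cylprob u pu.
pose s := [seq u ++ c | c <- words M g].
have ps : all posdigits s.
  apply/allP => _ /mapP[c /(allP (words_pos M g)) pc ->].
  by rewrite posdigits_cat pu.
have sE t : \sum_(c <- s) density c t = iter g (transfer R M) (density u) t.
  rewrite big_map -sum_density_words; apply: eq_bigr => c _.
  by rewrite density_cat mulrC.
pose E := 10 * C / 2 ^+ g + g%:R * (2 / M.+1%:R * (2 * C)).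
have osc x y : 0 <= x <= 1 -> 0 <= y <= 1 ->
    \sum_(c <- s) density c x <= \sum_(c <- s) density c y + E.
  by move=> x01 y01; rewrite !sE; apply: (iter_transfer_osc R M g (density u) (2 * C)).
have EL : E <= (20 / 2 ^+ g + g%:R * 8 / M.+1%:R) * cylprob u.
  have -> : E = (10 / 2 ^+ g + g%:R * 4 / M.+1%:R) * C by rewrite /E; ring.
  have -> : 20 / 2 ^+ g + g%:R * 8 / M.+1%:R = (10 / 2 ^+ g + g%:R * 4 / M.+1%:R) * 2 :> R by ring.
  by rewrite -[leRHS]mulrA; apply: ler_wpM2l.
clearbody E.
have tot : (1 - e / 4) * cylprob u <= \sum_(c <- s) cylprob c.
  rewrite big_map /cylprob -mulr_suml mulrA ler_pM2r ?invr_gt0 ?(ln2_gt0 R) //.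
  apply: le_trans (loglen_next_digits u M g pu H1).
  apply: ler_wpM2r; first exact/ltW/loglen_gt0.
  apply: le_trans (bernoulli_ge _ _ _); last by rewrite divr_ge0.
  by rewrite mulrA lerD2l lerN2.
(* The Gauss mean is at least [(1 - e / 4) * cylprob u] and the oscillation at most
   [(e / 2 + e / 4) * cylprob u], so every value is at least the difference. *)
have low t : 0 <= t <= 1 -> (1 - e) * cylprob u <= \sum_(c <- s) density c t.
  move=> t01.
  have := loglen_words_le s [::] (\sum_(c <- s) density c t + E) ps isT
    (fun x x01 => osc x t x01 t01).
  rewrite loglen_nil -ler_pdivrMr ?(ln2_gt0 R) //.
  under eq_bigr do rewrite cats0.
  rewrite mulr_suml -/(\sum_(c <- s) cylprob c) => h.
  have : (20 / 2 ^+ g + g%:R * 8 / M.+1%:R) * cylprob u <= (e / 2 + e / 4) * cylprob u.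
    by apply: ler_wpM2r; [exact/ltW/cylprob_gt0|rewrite lerD].
  move=> /(le_trans EL) k; have {tot h} := le_trans tot h.
  move: k; move: (\sum_(_ <- _) _) (cylprob u) => D z; lra.
have := loglen_words_ge s w _ ps pw low.
rewrite big_map; under eq_bigr do rewrite -catA.
by rewrite -(@ler_pM2r _ (ln 2)^-1) ?invr_gt0 ?(ln2_gt0 R) // mulr_suml -[leLHS]mulrA.
Qed.

End Mixing.

(** * Correlation of the digit [20] with itself *)

Section RepeatedDigit.
Variable R : realType.
Implicit Types (t x : R) (f : R -> R) (M g : nat).
Local Notation transfer := (transfer R).
Local Notation cylprob := (cylprob R).

Lemma transfer_ge M f b t : 0 <= b -> (forall x, 0 <= x <= 1 -> b <= f x) ->
  0 <= t <= 1 -> (1 - 2 / M.+1%:R) * b <= transfer M f t.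
Proof.
move=> b0 H t01; apply: le_trans (transfer_le R M (fun _ => b) f t H t01).
rewrite /transfer -mulr_suml ler_wpM2r // sum_digit_prob; last lra.
by have /andP[_ ?] := tail_prob_le R M t t01; rewrite lerD2l lerN2.
Qed.

Lemma iter_transfer_ge M g f b : 0 <= b -> 2 / M.+1%:R <= 1 :> R ->
  (forall x, 0 <= x <= 1 -> b <= f x) ->
  forall t, 0 <= t <= 1 -> (1 - 2 / M.+1%:R) ^+ g * b <= iter g (transfer M) f t.
Proof.
move=> b0 M1 H; elim: g => [|g IH] t t01; first by rewrite mul1r H.
rewrite iterS exprS -mulrA; apply: transfer_ge => //.
by rewrite mulr_ge0 // exprn_ge0 // subr_ge0.
Qed.

(* Seeing the digit [1] somewhere in between, which happens with conditional
   probability at least [1/3], makes a preceding [20] more likely than a following [20] does. *)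
Lemma transfer_1D M t : (0 < M)%N -> 0 <= t <= 1 ->
  1 - 2 / M.+1%:R + 1 / 6 <= transfer M (fun x => 1 + x) t.
Proof.
move=> M0 t01; rewrite /transfer.
under eq_bigr do rewrite mulrDr mulr1.
rewrite big_split /= sum_digit_prob; last lra.
apply: lerD; first by have /andP[_ ?] := tail_prob_le R M t t01; rewrite lerD2l lerN2.
rewrite big_ltn //.
apply: (@le_trans _ _ (digit_prob R 1 t * (1 + t)^-1)); last first.
  rewrite lerDl; apply: sumr_ge0 => n _.
  rewrite mulr_ge0 ?digit_prob_ge0 ?invr_ge0 //; first lra.
  by rewrite addr_ge0 //; lra.
rewrite [leRHS](_ : _ = ((1 + t) * (2 + t))^-1); last by rewrite /digit_prob; field; lra.
rewrite mul1r lef_pV2 ?posrE //; first nra.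
by rewrite mulr_gt0; lra.
Qed.

(** [462 = 21 * 22] is the largest value of the denominator. *)
Lemma digit20_ge x : 0 <= x <= 1 -> (1 + x) / 462 <= digit_prob R 20 x.
Proof.
move=> x01; rewrite /digit_prob.
have z1 : (20 + x) * (21 + x) <= 462 by nra.
have z0 : 0 < (20 + x) * (21 + x) by nra.
have k0 : 0 < 462 :> R by lra.
rewrite -[20%:R + x]/(20 + x) -[21%:R + x]/(21 + x).
move: ((20 + x) * (21 + x)) (462) z1 z0 k0 => z k z1 z0 k0.
by rewrite ler_wpM2l ?lef_pV2 ?posrE //; lra.
Qed.

(** The range of [x] is the one in force when the next partial quotient is also [20]. *)
Lemma digit20_le x : 0 <= x <= 1 / 20 -> digit_prob R 20 x <= 1 / 400.
Proof.
move=> x01; rewrite /digit_prob.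
have z0 : 0 < (20%:R + x) * (21%:R + x) by nra.
rewrite ler_pdivrMr; [nra|exact: z0].
Qed.

Lemma loglen_le_scale (u v : seq nat) (k : R) : posdigits u -> posdigits v ->
  (forall t, 0 <= t <= 1 -> density R u t <= k * density R v t) ->
  loglen R u <= k * loglen R v.
Proof.
move=> pu pv H.
have := @loglen_sum_ge0 R (R * seq nat) [:: (k, v); (-1, u)] (fun i => i.1) (fun i => i.2) [::].
rewrite /= pu pv !big_cons big_nil /= addr0 mulN1r !cats0 subr_ge0; apply => // t t01.
by rewrite !big_cons big_nil /= addr0 mulN1r subr_ge0 H.
Qed.

(** An adjacent [20] gives a density of at most [1 / 400]; a separated one gives, as [M] grows, at
    least [(1 + 1 / 6) / 462 = 1 / 396]. The surplus [e] is common to all gaps, while [M] depends on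
    the gap. *)
Lemma cylprob_20_gap : exists2 e : R, 0 < e & forall j, exists M,
  (1 + e) * cylprob [:: 20%N; 20%N] <=
  \sum_(c <- words M j.+1) cylprob (20%N :: c ++ [:: 20%N]).
Proof.
exists (1 / 1000); first lra.
move=> j.
have [M1 H1] := small_inv_nat R (j.+1%:R * 2) (1 / 500) (mulr_ge0 (ler0n _ _) (ler0n _ 2)) ltac:(lra).
exists M1.+1; have {H1} := H1 M1.+1 (leqnSn _).
set M := M1.+1; pose r : R := 1 - 2 / M.+1%:R.
have n1 : 0 < M.+1%:R :> R by [].
rewrite -mulrA => Hj.
have q0 : 0 <= 2 / M.+1%:R :> R by rewrite divr_ge0.
have q1 : 2 / M.+1%:R <= 1 :> R.
  apply: (@le_trans _ _ (j.+1%:R * (2 / M.+1%:R))); last by apply: (le_trans Hj); lra.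
  by rewrite ler_peMl // ler1n.
have rj : 499 / 500 <= r ^+ j.+1.
  apply: le_trans (bernoulli_ge R (2 / M.+1%:R) j.+1 _); last by rewrite q0 q1.
  by move: Hj; move: (j.+1%:R * _) => z; lra.
have r01 : 0 <= r <= 1 by move: q0 q1; rewrite /r; move: (2 / _) => z; lra.
(* [1 / 398] absorbs the truncation loss from [1 / 396] and leaves [400 / 398 > 1 + 1 / 1000]. *)
have low t : 0 <= t <= 1 -> 1 / 398 <=
    \sum_(c <- [seq 20%N :: c | c <- words M j.+1]) density R c t.
  move=> t01; rewrite big_map /=.
  under eq_bigr do rewrite mulrC.
  rewrite (sum_density_words R M j.+1 (digit_prob R 20)) iterSr.
  have b0 : 0 <= (r + 1 / 6) / 462 by lra.
  have bf x : 0 <= x <= 1 -> (r + 1 / 6) / 462 <= transfer M (digit_prob R 20) x.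
    move=> x01; apply: le_trans (transfer_le R M (fun x => (1 + x) / 462) _ x digit20_ge x01).
    rewrite /transfer; under eq_bigr do rewrite mulrA.
    rewrite -mulr_suml; apply: ler_wpM2r; first by rewrite invr_ge0 ler0n.
    exact: transfer_1D.
  apply: le_trans (iter_transfer_ge M j _ _ b0 q1 bf t t01).
  rewrite -/r; clear b0 bf.
  have : r ^+ j.+1 <= r ^+ j by rewrite exprSr ler_piMr ?exprn_ge0 //; lra.
  by move: rj; rewrite exprSr; move: (r ^+ j) => z; lra.
have := loglen_words_ge R [seq 20%N :: c | c <- words M j.+1] [:: 20%N] (1 / 398) _ isT low.
rewrite big_map all_map => /(_ (words_pos M j.+1)) /= G.
have S : loglen R [:: 20%N; 20%N] <= 1 / 400 * loglen R [:: 20%N].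
  apply: loglen_le_scale => // t t01.
  have t0 : 0 <= t by lra.
  rewrite -[density R _ t]/(digit_prob R 20 (20%:R + t)^-1 * density R [:: 20%N] t).
  apply: ler_wpM2r; first exact/ltW/density_gt0.
  have h : 0 < 20%:R + t by rewrite ltr_wpDr.
  by apply: digit20_le; rewrite invr_ge0 (ltW h) mul1r lef_pV2 ?posrE // lerDl.
rewrite /cylprob -mulr_suml mulrA ler_pM2r ?invr_gt0 ?(ln2_gt0 R) //.
have := loglen_gt0 R [:: 20%N] isT.
move: S G; move: (loglen R [:: 20%N]) (loglen R [:: 20%N; 20%N]) => a b; lra.
Qed.

End RepeatedDigit.

(** * Independence from zero entropy sequences *)

Section AsymptoticInequality.
Variable R : realType.
Implicit Types (u v w : nat -> R) (a b c : R).

(* [limsup (u - v) <= 0] *)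
Definition asymle u v := forall e : R, 0 < e -> \forall k \near \oo, u k <= v k + e.

Lemma asymle_pointwise u v : (forall k, u k <= v k) -> asymle u v.
Proof. by move=> H e e0; apply: nearW => k; have := H k; lra. Qed.

Lemma asymle_trans v u w : asymle u v -> asymle v w -> asymle u w.
Proof.
move=> uv vw e e0; have e2 : 0 < e / 2 by lra.
have := uv _ e2; apply: filterS2 (vw _ e2) => k; lra.
Qed.

Lemma asymleD u v u' v' : asymle u v -> asymle u' v' ->
  asymle (fun k => u k + u' k) (fun k => v k + v' k).
Proof.
move=> uv vw e e0; have e2 : 0 < e / 2 by lra.
have := uv _ e2; apply: filterS2 (vw _ e2) => k; lra.
Qed.

Lemma asymleZ c u v : 0 <= c -> asymle u v -> asymle (fun k => c * u k) (fun k => c * v k).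
Proof.
move=> c0 uv e e0; have ec : 0 < e / (c + 1) by rewrite divr_gt0; lra.
apply: filterS (uv _ ec) => k uvk.
apply: (le_trans (ler_wpM2l c0 uvk)); rewrite mulrDr lerD2l mulrCA ler_piMr ?(ltW e0) //.
by rewrite ler_pdivrMr; lra.
Qed.

Lemma asymleN u v : asymle u v -> asymle (fun k => - v k) (fun k => - u k).
Proof. by move=> uv e e0; apply: filterS (uv _ e0) => k; lra. Qed.

Lemma asymle_sum (I : eqType) (r : seq I) (F G : I -> nat -> R) :
  (forall i, i \in r -> asymle (F i) (G i)) ->
  asymle (fun k => \sum_(i <- r) F i k) (fun k => \sum_(i <- r) G i k).
Proof.
elim: r => [|i r IH] H.
  by apply: asymle_pointwise => k; rewrite !big_nil.
apply: (asymle_trans (fun k => F i k + \sum_(j <- r) F j k)).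
  by apply: asymle_pointwise => k; rewrite big_cons.
have Hr j : j \in r -> asymle (F j) (G j) by move=> jr; apply: H; rewrite inE jr orbT.
apply: (asymle_trans _ _ _ (asymleD _ _ _ _ (H i (mem_head _ _)) (IH Hr))).
by apply: asymle_pointwise => k; rewrite big_cons.
Qed.

Lemma asymle_cst a b : asymle (fun=> a) (fun=> b) -> a <= b.
Proof.
move=> H; apply/ler_addgt0Pr => e e0.
by have [k _ /(_ k (leqnn k))] := H e e0.
Qed.

Lemma cvg_asymle u c : u @ \oo --> c -> asymle u (fun=> c).
Proof.
move=> /cvgrPdist_le H e e0; apply: filterS (H e e0) => k.
by rewrite ler_norml => /andP[? ?]; lra.
Qed.

Lemma cvg_asymge u c : u @ \oo --> c -> asymle (fun=> c) u.
Proof.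
move=> /cvgrPdist_le H e e0; apply: filterS (H e e0) => k.
by rewrite ler_norml => /andP[? ?]; lra.
Qed.

(** Lets auxiliary parameters be chosen after the tolerance. *)
Lemma asymle_approx c u :
  (forall e : R, 0 < e -> asymle (fun=> c - e) u) -> asymle (fun=> c) u.
Proof.
move=> H e e0; have e2 : 0 < e / 2 by lra.
apply: filterS (H _ e2 _ e2) => k; lra.
Qed.

End AsymptoticInequality.
Arguments asymle_trans {R} v {u w}.
Arguments asymleD {R u v u' v'}.
Arguments asymleZ {R} c {u v}.
Arguments asymleN {R u v}.

(** * Words and occurrence indicators *)

Section Words.
Variables (T : eqType).
Implicit Types (a : nat -> T) (u v : seq T) (i L : nat).

Definition word a i L := mkseq (fun j => a (i + j)%N) L.

Lemma size_word a i L : size (word a i L) = L.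
Proof. exact: size_mkseq. Qed.

Lemma nth_word x0 a i L j : (j < L)%N -> nth x0 (word a i L) j = a (i + j)%N.
Proof. exact: nth_mkseq. Qed.

Lemma word_cat a i L1 L2 : word a i (L1 + L2) = word a i L1 ++ word a (i + L1) L2.
Proof.
rewrite /word /mkseq iotaD map_cat add0n; congr (_ ++ _).
rewrite -[in LHS](addn0 L1) iotaDl -map_comp; apply: eq_map => j /=.
by rewrite addnA.
Qed.

Lemma word_sub a i L s l : (s + l <= L)%N -> take l (drop s (word a i L)) = word a (i + s) l.
Proof.
move=> slL; rewrite -(subnKC slL) -addnA word_cat drop_size_cat ?size_word //.
by rewrite word_cat take_size_cat ?size_word.
Qed.

Variable R : realType.
Definition occ a u i : R := (word a i (size u) == u)%:R.

Lemma occ01 a u i : 0 <= occ a u i <= 1.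
Proof. by rewrite /occ; case: (_ == _); rewrite /= ?lexx ?ler01. Qed.

Lemma occ1 a x i : occ a [:: x] i = (a i == x)%:R.
Proof. by rewrite /occ /word /mkseq /= addn0 eqseq_cons andbT. Qed.

Lemma occ_ge0 a u i : 0 <= occ a u i.
Proof. by rewrite ler0n. Qed.

Lemma occ_cat a u v i : occ a (u ++ v) i = occ a u i * occ a v (i + size u).
Proof.
by rewrite /occ size_cat word_cat eqseq_cat ?size_word // -natrM mulnb.
Qed.

(** Distinct words of equal length cannot both occur at [i], so at most one term survives. *)
Lemma sum_occ a (W : seq (seq T)) L (f : seq T -> R) i :
  uniq W -> (forall u, u \in W -> size u = L) ->
  \sum_(u <- W) f u * occ a u i = (word a i L \in W)%:R * f (word a i L).
Proof.
move=> uW sW; rewrite big_seq.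
under eq_bigr => u uW' do rewrite /occ (sW u uW').
rewrite -big_seq; elim: W uW {sW} => [|u W IH] /=; first by rewrite big_nil mul0r.
move=> /andP[nu /IH {}IH]; rewrite big_cons IH inE.
case: eqVneq => [->|_] /=; last by rewrite mulr0 add0r.
by rewrite (negbTE nu) mul0r addr0 mulr1 mul1r.
Qed.

End Words.
Arguments word {T} a i L.
Arguments word_sub {T} a i {L s l}.
Arguments occ {T} R a u i.
Arguments occ1 {T} R a x i.
Arguments occ_ge0 {T} R a u i.
Arguments occ01 {T} R a u i.
Arguments sum_occ {T} R a W {L} f i.

(** * Averages along a subsequence of lengths *)

Section Averages.
Variables (R : realType) (phi : nat -> nat).
Hypothesis phi_incr : forall k, (phi k < phi k.+1)%N.
Implicit Types (F G : nat -> R).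

Definition avg F (k : nat) : R := (phi k)%:R^-1 * \sum_(i < phi k) F i.

Lemma leq_phi k : (k <= phi k)%N.
Proof. by elim: k => // k IH; apply: (leq_ltn_trans IH). Qed.

Lemma avg_le F G k : (forall i, F i <= G i) -> avg F k <= avg G k.
Proof. by move=> FG; rewrite ler_wpM2l ?invr_ge0 // ler_sum. Qed.

Lemma avgD F G k : avg (fun i => F i + G i) k = avg F k + avg G k.
Proof. by rewrite /avg big_split mulrDr. Qed.

Lemma avgZ c F k : avg (fun i => c * F i) k = c * avg F k.
Proof. by rewrite /avg -mulr_sumr mulrCA. Qed.

Lemma avg_sum (I : Type) (r : seq I) (F : I -> nat -> R) k :
  avg (fun i => \sum_(x <- r) F x i) k = \sum_(x <- r) avg (F x) k.
Proof. by rewrite /avg exchange_big /= mulr_sumr. Qed.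

Lemma eq_avg F G k : F =1 G -> avg F k = avg G k.
Proof. by move=> FG; rewrite /avg; congr (_ * _); apply: eq_bigr => i _. Qed.

Lemma avg_cst_le c k : 0 <= c -> avg (fun=> c) k <= c.
Proof.
move=> c0; rewrite /avg sumr_const card_ord -[c *+ _]mulr_natl mulrA.
(* When [phi k = 0] the average is [0] by the convention on inverses, hence the sign condition on
   [c]. *)
by have [->|n0] := eqVneq (phi k) 0%N; rewrite ?invr0 ?mul0r // mulVf ?mul1r ?pnatr_eq0.
Qed.

Lemma avg_cst c : asymle R (fun=> c) (avg (fun=> c)) /\ asymle R (avg (fun=> c)) (fun=> c).
Proof.
have H : \forall k \near \oo, avg (fun=> c) k = c.
  exists 1%N => // k /= k1; rewrite /avg sumr_const card_ord -[c *+ _]mulr_natl mulrA mulVf ?mul1r //.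
  by rewrite pnatr_eq0 -lt0n (leq_trans k1) ?leq_phi.
by split=> e e0; apply: filterS H => k ->; rewrite lerDl ltW.
Qed.

(** The two sums differ by [F (phi k) - F 0], bounded while [phi k] tends to infinity. *)
Lemma avg_shift1 F B : (forall i, `|F i| <= B) ->
  asymle R (avg F) (avg (fun i => F (i.+1))) /\ asymle R (avg (fun i => F (i.+1))) (avg F).
Proof.
move=> FB.
have E k : avg (fun i => F i.+1) k - avg F k = (phi k)%:R^-1 * (F (phi k) - F 0%N).
  rewrite /avg -mulrBr; congr (_ * _).
  elim: (phi k) => [|n IH]; first by rewrite !big_ord0 !subrr.
  by rewrite !big_ord_recr /=; move: IH; lra.
have B0 : 0 <= B by apply: le_trans (FB 0%N).
have H e : 0 < e -> \forall k \near \oo, `|avg (fun i => F i.+1) k - avg F k| <= e.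
  move=> e0; have [M HM] := small_inv_nat R (2 * B) e ltac:(lra) e0.
  exists M.+1 => // k /= Mk; rewrite E normrM.
  have pk : (M < phi k)%N by rewrite (leq_trans Mk) ?leq_phi.
  have := HM (phi k).-1; rewrite prednK; last by case: (phi k) pk.
  move=> /(_ ltac:(lia)); apply: le_trans.
  rewrite mulrC [`|_^-1|]ger0_norm ?invr_ge0 // ler_wpM2r ?invr_ge0 //.
  by have := FB (phi k); have := FB 0%N; have := ler_normB (F (phi k)) (F 0%N); lra.
by split=> e /H; apply: filterS => k; rewrite ler_norml => /andP[? ?]; lra.
Qed.

Lemma avg_shift F B s : (forall i, `|F i| <= B) ->
  asymle R (avg F) (avg (fun i => F (i + s)%N)) /\ asymle R (avg (fun i => F (i + s)%N)) (avg F).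
Proof.
elim: s F => [|s IH] F FB.
  by split; apply: asymle_pointwise => k; apply: avg_le => i; rewrite addn0.
have [H1 H2] := IH F FB.
have [H3 H4] := avg_shift1 (fun i => F (i + s)%N) B (fun i => FB _).
split.
  apply: (asymle_trans _ H1); apply: (asymle_trans _ H3).
  by apply: asymle_pointwise => k; apply: avg_le => i; rewrite addSnnS.
apply: asymle_trans H2; apply: asymle_trans H4.
by apply: asymle_pointwise => k; apply: avg_le => i; rewrite addSnnS.
Qed.

End Averages.

(** * Mixing along a normal sequence *)

Section Independence.
Variables (R : realType) (phi : nat -> nat).
Hypothesis phi_incr : forall k, (phi k < phi k.+1)%N.
Variables (a : nat -> nat) (y : nat -> bool) (q : seq bool -> R).
Local Notation avg := (avg R phi).
Local Notation asymle := (asymle R).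
Local Notation cylprob := (cylprob R).
Hypothesis a_normal : forall u, posdigits u -> avg (occ R a u) @ \oo --> cylprob u.
Hypothesis y_freq : forall v, avg (occ R y v) @ \oo --> q v.

Lemma cylprob_le1 u : posdigits u -> cylprob u <= 1.
Proof.
move=> pu; apply: asymle_cst; apply: asymle_trans (cvg_asymge _ _ _ (a_normal u pu)) _.
apply: asymle_pointwise => k; apply: le_trans (avg_cst_le R phi 1 k ler01).
by apply: avg_le => i; have /andP[] := occ01 R a u i.
Qed.

Lemma q_ge0 v : 0 <= q v.
Proof.
apply: (@asymle_cst R); apply: asymle_trans (cvg_asymle _ _ _ (y_freq v)).
apply: asymle_pointwise => k; by rewrite mulr_ge0 ?invr_ge0 // sumr_ge0.
Qed.

(** Expand [f] over the windows [u] of length [L] and sum over the words [c] filling the gap. Only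
    finitely many [u] can be handled at once, whence the auxiliary [eta]. *)
Lemma mixing_step (e : R) g M (f : seq nat -> R) L w : 0 < e < 1 ->
  (forall u w, posdigits u -> posdigits w ->
    (1 - e) * cylprob u * cylprob w <= \sum_(c <- words M g) cylprob (u ++ c ++ w)) ->
  (forall v, 0 <= f v <= 1) -> posdigits w ->
  asymle (fun k => (1 - e) * cylprob w * avg (fun i => f (word a i L)) k)
    (avg (fun i => f (word a i L) * occ R a w (i + L + g)%N)).
Proof.
move=> e01 mix f01 pw.
have p0 : 0 < cylprob w by apply: cylprob_gt0.
have p1 : cylprob w <= 1 by apply: cylprob_le1.
have f0 v : 0 <= f v by have /andP[] := f01 v.
pose r := (1 - e) * cylprob w.
have r0 : 0 <= r by rewrite mulr_ge0; lra.
have r1 : r <= 1 by rewrite mulr_ile1; lra.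
suff H eta : 0 < eta -> asymle (fun k => r * avg (fun i => f (word a i L)) k - eta)
    (avg (fun i => f (word a i L) * occ R a w (i + L + g)%N)).
  move=> eta eta0; have e2 : 0 < eta / 2 by lra.
  by apply: filterS (H _ e2 _ e2) => k; rewrite /r; lra.
move=> eta0; have [M0 HM0] := words_tight R L eta eta0.
pose W := words M0 L.
have uW : uniq W by apply: words_uniq.
have sW u : u \in W -> size u = L by apply: words_size.
have pW := words_pos M0 L.
have pWi u : u \in W -> posdigits u by move/(allP pW).
(* Outside [W] the bound [f <= 1] is used, so unlisted windows contribute at most [1] minus the mass
   of [W]. *)
have up : asymle (avg (fun i => f (word a i L)))
    (fun=> \sum_(u <- W) f u * cylprob u + (1 - \sum_(u <- W) cylprob u)).
  apply: (asymle_trans (fun k => \sum_(u <- W) (f u - 1) * avg (occ R a u) k + 1)).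
    apply: asymle_pointwise => k.
    apply: (@le_trans _ _ (avg (fun i => \sum_(u <- W) (f u - 1) * occ R a u i + 1) k)).
      apply: avg_le => i; rewrite (@sum_occ _ _ _ _ L) //.
      have /andP[? ?] := f01 (word a i L).
      by case: (_ \in _); rewrite ?mul1r ?mul0r; lra.
    rewrite avgD avg_sum; apply: lerD; last exact: avg_cst_le.
    by apply: ler_sum => u _; rewrite avgZ.
  have -> : \sum_(u <- W) f u * cylprob u + (1 - \sum_(u <- W) cylprob u) =
      \sum_(u <- W) (f u - 1) * cylprob u + 1.
    under [in RHS]eq_bigr do rewrite mulrBl mul1r.
    rewrite sumrB; lra.
  apply: asymleD; last by apply: asymle_pointwise.
  apply: asymle_sum => u uin.
  (* Since [f u - 1 <= 0], the upper bound comes from the lower bound on the frequency of [u]. *)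
  have := asymleZ (1 - f u) _ (cvg_asymge _ _ _ (a_normal u (pWi u uin))).
  move=> /(_ _)/asymleN; rewrite /=.
  have /andP[? ?] := f01 u.
  move=> H; apply: (asymle_trans (fun k => - ((1 - f u) * avg (occ R a u) k))).
    by apply: asymle_pointwise => k; lra.
  apply: asymle_trans (H _) _; first lra.
  by apply: asymle_pointwise => k; lra.
have low : asymle (fun=> \sum_(u <- W) f u * (r * cylprob u))
    (avg (fun i => f (word a i L) * occ R a w (i + L + g)%N)).
  apply: (asymle_trans (fun k => \sum_(u <- W) f u * \sum_(c <- words M g) avg (occ R a (u ++ c ++ w)) k)).
    apply: asymle_sum => u uin.
    apply: asymleZ; first exact: f0.
    apply: (asymle_trans (fun k => \sum_(c <- words M g) cylprob (u ++ c ++ w))).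
      apply: asymle_pointwise => k; rewrite /r mulrAC; exact: mix (pWi u uin) pw.
    apply: asymle_sum => c cin.
    apply: cvg_asymge; apply: a_normal.
    by rewrite !posdigits_cat pw andbT (pWi u uin) /= (allP (words_pos M g)).
  apply: asymle_pointwise => k.
  under eq_bigr do rewrite -avg_sum -avgZ.
  rewrite -avg_sum; apply: avg_le => i.
  apply: (@le_trans _ _ (\sum_(u <- W) f u * occ R a u i * occ R a w (i + L + g)%N)).
    rewrite big_seq [leRHS]big_seq; apply: ler_sum => u uin.
    rewrite -mulrA; apply: ler_wpM2l; first exact: f0.
    rewrite big_seq; under eq_bigr => c cin.
      rewrite !occ_cat (sW u uin) (words_size _ _ _ cin); over.
    rewrite -big_seq -mulr_sumr; apply: ler_wpM2l; first exact: occ_ge0.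
    rewrite -mulr_suml; apply: ler_piMl; first exact: occ_ge0.
    have := sum_occ R a (words M g) (fun=> 1) (i + L)%N (words_uniq M g) (@words_size M g).
    under eq_bigr do rewrite mul1r.
    by move=> ->; rewrite mulr1; case: (_ \in _); rewrite ?ler01 ?lexx.
  rewrite -mulr_suml (@sum_occ _ _ _ _ L) //; apply: ler_wpM2r; first exact: occ_ge0.
  by have /andP[? ?] := f01 (word a i L); case: (_ \in _); rewrite ?mul1r ?mul0r.
apply: asymle_trans low.
apply: (asymle_trans (fun k => r * (\sum_(u <- W) f u * cylprob u + (1 - \sum_(u <- W) cylprob u)) - eta)).
  by apply: asymleD; [exact: asymleZ|exact: asymle_pointwise].
apply: asymle_pointwise => k.
under [leRHS]eq_bigr do rewrite mulrCA.
rewrite -mulr_sumr mulrDr -addrA gerDl.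
have : r * (1 - \sum_(u <- W) cylprob u) <= r * eta by rewrite ler_wpM2l //; rewrite /W; lra.
have : r * eta <= eta by rewrite ler_piMl; lra.
lra.
Qed.

Section Avoidance.
Variables (e kap : R) (g M : nat) (w : seq nat).
Hypothesis e01 : 0 < e < 1.
Hypothesis kap01 : 0 <= kap <= 1.
Hypothesis mix : forall u w, posdigits u -> posdigits w ->
  (1 - e) * cylprob u * cylprob w <= \sum_(c <- words M g) cylprob (u ++ c ++ w).
Hypothesis pw : posdigits w.
(** Each block of length [d] is a gap of [g] digits followed by a window in which [w] is sought. *)
Let d := (g + size w)%N.

(** For [kap = 1] this is the indicator that [w] is missed in all windows selected by [b]; for
    [kap < 1] it stays positive and so has a logarithm. *)
Definition hits (b : nat -> bool) n i : R :=
  \prod_(j < n) (if b j then 1 - kap * occ R a w (i + (j * d + g))%N else 1).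

Definition hits_word (b : nat -> bool) n (v : seq nat) : R :=
  \prod_(j < n) (if b j then 1 - kap * (take (size w) (drop (j * d + g) v) == w)%:R else 1).

Lemma hitsE b n i : hits b n i = hits_word b n (word a i (n * d)).
Proof.
apply: eq_bigr => j _; case: (b j) => //; rewrite word_sub // -addnA.
have : (j.+1 * d <= n * d)%N by rewrite leq_mul2r ltn_ord orbT.
by rewrite mulSn addnC.
Qed.

Lemma factor01 (bj t : bool) : 0 <= (if bj then 1 - kap * t%:R else 1) <= 1.
Proof.
move: kap01 => /andP[k0 k1].
case: bj; case: t; rewrite /= ?mulr1n ?mulr0n ?mulr1 ?mulr0 ?subr0 ?lexx ?ler01 //.
by rewrite subr_ge0 k1 gerBl.
Qed.

Lemma hits_word01 b n v : 0 <= hits_word b n v <= 1.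
Proof.
apply/andP; split; first by apply: prodr_ge0 => j _; have /andP[] := factor01 (b j) (take (size w) (drop (j * d + g) v) == w).
by apply: prodr_ile1 => j _; apply: factor01.
Qed.

(** Induction on blocks: the earlier factors depend on the first [n * d] digits only, and the last
    window follows them after a gap [g], so [mixing_step] applies. *)
Lemma avg_hits_le b n :
  asymle (avg (hits b n))
    (fun=> \prod_(j < n) (if b j then 1 - kap * ((1 - e) * cylprob w) else 1)).
Proof.
elim: n => [|n IH].
  rewrite big_ord0; apply: asymle_trans (proj2 (avg_cst R phi phi_incr 1)).
  by apply: asymle_pointwise => k; apply: avg_le => i; rewrite /hits big_ord0.
rewrite big_ord_recr /=.
set P := \prod_(j < n) _ in IH *.
have step i : hits b n.+1 i = hits b n i *
    (if b n then 1 - kap * occ R a w (i + n * d + g)%N else 1).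
  by rewrite /hits big_ord_recr /= addnA.
case: (b n) step => step; last first.
  apply: asymle_trans (asymle_trans _ IH _); last first.
    by apply: asymle_pointwise => k; rewrite mulr1.
  by apply: asymle_pointwise => k; apply: avg_le => i; rewrite step mulr1.
have ms := mixing_step e g M (hits_word b n) (n * d) w e01 mix (hits_word01 b n) pw.
set r := (1 - e) * cylprob w in ms *.
have p0 := cylprob_gt0 R w pw; have p1 := cylprob_le1 w pw.
have e01' := e01; have kap01' := kap01.
have r0 : 0 <= r by rewrite mulr_ge0; lra.
have r1 : r <= 1 by rewrite mulr_ile1; lra.
have kr : kap * r <= 1 by rewrite mulr_ile1 //; lra.
apply: (asymle_trans (fun k => avg (hits b n) k - kap *
   avg (fun i => hits_word b n (word a i (n * d)) * occ R a w (i + n * d + g)%N) k)).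
  apply: asymle_pointwise => k; rewrite -mulNr -avgZ -avgD; apply: avg_le => i.
  by rewrite step hitsE; lra.
apply: (asymle_trans (fun k => avg (hits b n) k - kap * (r * avg (hits b n) k))).
  apply: asymleD; first exact: asymle_pointwise.
  apply: asymleN; apply: asymleZ; first lra.
  apply: asymle_trans ms; apply: asymle_pointwise => k.
  by rewrite ler_wpM2l //; apply: avg_le => i; rewrite hitsE.
apply: (asymle_trans (fun k => (1 - kap * r) * avg (hits b n) k)).
  by apply: asymle_pointwise => k; lra.
apply: (asymle_trans (fun k => (1 - kap * r) * P)).
  by apply: asymleZ => //; lra.
by apply: asymle_pointwise => k; rewrite mulrC.
Qed.

End Avoidance.

End Independence.

(** * Joint frequencies with a zero entropy sequence *)

Section ZeroEntropyIndependence.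
Variables (R : realType) (phi : nat -> nat).
Hypothesis phi_incr : forall k, (phi k < phi k.+1)%N.
Variables (a : nat -> nat) (y : nat -> bool) (q : seq bool -> R).
Local Notation avg := (avg R phi).
Local Notation asymle := (asymle R).
Local Notation cylprob := (cylprob R).
Hypothesis a_normal : forall u, posdigits u -> avg (occ R a u) @ \oo --> cylprob u.
Hypothesis y_freq : forall v, avg (occ R y v) @ \oo --> q v.
Hypothesis q_zero_entropy : forall (d : nat) (eta : R), (0 < d)%N -> 0 < eta ->
  exists2 n, (0 < n)%N & - \sum_(v : (n * d).-tuple bool) q v * ln (q v) <= eta * n%:R.

Section FixedParameters.
Variables (e : R) (g M : nat) (w : seq nat) (B : seq bool).
Hypothesis e01 : 0 < e < 1.
Hypothesis mix : forall u w, posdigits u -> posdigits w ->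
  (1 - e) * cylprob u * cylprob w <= \sum_(c <- words M g) cylprob (u ++ c ++ w).
Hypothesis pw : posdigits w.
Hypothesis sB : size B = size w.
Hypothesis w0 : (0 < size w)%N.

Let d := (g + size w)%N.
(** With this [tau], [exp (- tau * occ)] equals [1 - e * occ], which is the factor in [hits] for
    [kap = e]; [r] is the matching bound in [avg_hits_le]. *)
Let tau : R := - ln (1 - e).
Let r : R := 1 - e * ((1 - e) * cylprob w).

Lemma tau_gt0 : 0 < tau.
Proof. by have e01' := e01; rewrite oppr_gt0; apply: ln_lt0; apply/andP; split; lra. Qed.

Lemma r_itv : 0 < r <= 1 /\ ln r <= r - 1.
Proof.
have e01' := e01; have p0 := cylprob_gt0 R w pw.
have p1 := cylprob_le1 R phi a a_normal w pw.
have h0 : 0 < e * ((1 - e) * cylprob w) by apply: mulr_gt0; [lra|apply: mulr_gt0; lra].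
have h1 : e * ((1 - e) * cylprob w) < 1.
  apply: (@le_lt_trans _ _ (e * 1)); last lra.
  apply: ler_wpM2l; first lra.
  by apply: mulr_ile1; lra.
rewrite /r; split; first lra.
have := @le_ln1Dx R (- (e * ((1 - e) * cylprob w))); rewrite ltrN2 h1 => /(_ isT); lra.
Qed.

Definition hit_weight (b : nat -> bool) n i : R :=
  \sum_(j < n) (if b j then tau * occ R a w (i + (j * d + g))%N + ln r else 0).

Lemma hit_weight_bound b n i : `|hit_weight b n i| <= n%:R * (tau - ln r).
Proof.
have t0 := tau_gt0; have [r01 lr] := r_itv.
have l0 : ln r <= 0 by lra.
apply: (le_trans (ler_norm_sum _ _ _)).
apply: (@le_trans _ _ (\sum_(j < n) (tau - ln r))).
  apply: ler_sum => j _; case: (b j); last by rewrite normr0; lra.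
  have /andP[oc0 oc1] := occ01 R a w (i + (j * d + g))%N.
  have h0 : 0 <= tau * occ R a w (i + (j * d + g))%N by apply: mulr_ge0; lra.
  have h1 : tau * occ R a w (i + (j * d + g))%N <= tau by apply: ler_piMr; lra.
  by rewrite ler_norml; lra.
by rewrite sumr_const card_ord -[leLHS]mulr_natl.
Qed.

(** Divided by the product of the [r], [avg_hits_le] becomes the bound [1] on the asymptotic mean of
    [exp (- hit_weight)]. *)
Lemma exp_hit_weight b n i : hits R a e g w b n i =
  \prod_(j < n) (if b j then r else 1) * expR (- hit_weight b n i).
Proof.
have e01' := e01; have [/andP[r0 _] _] := r_itv.
rewrite /hits /hit_weight -sumrN expR_sum -big_split /=; apply: eq_bigr => j _.
case: (b j); last by rewrite oppr0 expR0 mulr1.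
rewrite opprD expRD [expR (- ln r)]expRN lnK ?posrE // -[- (tau * _)]mulNr /tau opprK.
rewrite [r * _]mulrC mulrAC -mulrA divff ?lt0r_neq0 // mulr1.
rewrite /occ; case: (_ == _); rewrite /= ?mulr1n ?mulr0n ?mulr1 ?mulr0 ?subr0 ?expR0 //.
by rewrite lnK // posrE; lra.
Qed.

(** With [W = hit_weight b n], average [q v * exp (- W) >= 1 + ln (q v) - W] over the occurrences of
    [v]: the left side contributes at most [q v] and the constant [(1 + ln (q v)) * q v]. *)
Lemma weighted_avg_ge b n v :
  asymle (fun=> q v * ln (q v)) (avg (fun i => occ R y v i * hit_weight b n i)).
Proof.
have q0 := q_ge0 R phi y q y_freq v.
have e01' := e01; have [/andP[r0 _] _] := r_itv.
(* A window of frequency zero contributes nothing in the limit because [hit_weight] is bounded. *)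
have [qv0|qn0] := eqVneq (q v) 0.
  rewrite qv0 mul0r; set K := n%:R * (tau - ln r).
  apply: (asymle_trans (fun k => - (K * avg (occ R y v) k))).
    apply: (asymle_trans (fun k => - (K * q v))).
      by apply: asymle_pointwise => k; rewrite qv0 mulr0 oppr0.
    apply: asymleN; apply: asymleZ; last exact: cvg_asymle.
    exact: le_trans (normr_ge0 _) (hit_weight_bound b n 0).
  apply: asymle_pointwise => k; rewrite -mulNr -avgZ; apply: avg_le => i.
  rewrite mulrC; apply: ler_wpM2l; first exact: occ_ge0.
  by have := hit_weight_bound b n i; rewrite ler_norml => /andP[].
have {q0} qn : 0 < q v by rewrite lt_def qn0.
set rho : R := \prod_(j < n) (if b j then r else 1).
have rho0 : 0 < rho by apply: prodr_gt0 => j _; case: (b j).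
have ah := avg_hits_le R phi phi_incr a a_normal e e g M w e01 _ mix pw b n.
have {}ah := ah ltac:(lra).
apply: (asymle_trans (fun k => (1 + ln (q v)) * avg (occ R y v) k - q v / rho * avg (hits R a e g w b n) k)); last first.
  apply: asymle_pointwise => k; rewrite -mulNr -!avgZ -avgD; apply: avg_le => i.
  rewrite exp_hit_weight -/rho mulNr mulrA divfK ?lt0r_neq0 //.
  have := @expR_ge1Dx R (ln (q v) - hit_weight b n i).
  rewrite expRD lnK ?posrE //.
  (* Where [v] does not occur, positivity of the exponential suffices. *)
  have : 0 < q v * expR (- hit_weight b n i) by rewrite mulr_gt0 ?expR_gt0.
  rewrite /occ; case: (_ == _); rewrite /= ?mulr1n ?mulr0n; lra.
apply: (asymle_trans (fun k => (1 + ln (q v)) * q v - q v / rho * rho)).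
  by apply: asymle_pointwise => k; rewrite divfK ?lt0r_neq0 //; lra.
apply: asymleD.
  have [l0|l0] := leP 0 (1 + ln (q v)); first by apply: asymleZ => //; exact: cvg_asymge.
  have := asymleN (asymleZ (- (1 + ln (q v))) _ (cvg_asymle _ _ _ (y_freq v))).
  move=> /(_ ltac:(lra)) H; apply: (asymle_trans (fun k => - (- (1 + ln (q v)) * q v))).
    by apply: asymle_pointwise => k; lra.
  by apply: (asymle_trans _ H); apply: asymle_pointwise => k; lra.
apply: asymleN; apply: asymleZ; first by rewrite divr_ge0 ?ltW.
exact: ah.
Qed.

Let G i : R := occ R y B i * (tau * occ R a w i + ln r).

(** Only the window actually read at [i] contributes, and it then tells in which blocks [B]
    occurs. *)
Lemma sum_hit_weight n i :
  \sum_(v : (n * d).-tuple bool) occ R y v i *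
     hit_weight (fun j => take (size w) (drop (j * d + g) v) == B) n i =
  \sum_(j < n) G (i + (j * d + g))%N.
Proof.
have sw : size (word y i (n * d)) == (n * d)%N by rewrite size_word.
rewrite (bigD1 (Tuple sw)) //= big1 ?addr0 => [|v vn]; last first.
  rewrite /occ size_tuple; case: eqP => [E|_]; last by rewrite mul0r.
  by case/eqP: vn; apply/val_inj.
rewrite /occ size_word eqxx mul1r; apply: eq_bigr => j _.
rewrite /G /occ word_sub; last first.
  rewrite -addnA; have : (j.+1 * d <= n * d)%N by rewrite leq_mul2r ltn_ord orbT.
  by rewrite mulSn addnC.
rewrite sB; case: (_ == B); rewrite /= ?mul1r ?mul0r //.
Qed.

Lemma G_bound i : `|G i| <= tau - ln r.
Proof.
have t0 := tau_gt0; have [r01 lr] := r_itv.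
have l0 : ln r <= 0 by lra.
have /andP[oc0 oc1] := occ01 R a w i.
have h0 : 0 <= tau * occ R a w i by apply: mulr_ge0; lra.
have h1 : tau * occ R a w i <= tau by apply: ler_piMr; lra.
have h2 : `|tau * occ R a w i + ln r| <= tau - ln r by rewrite ler_norml; lra.
rewrite /G normrM; apply: le_trans h2; apply: ler_piMl => //.
by rewrite ger0_norm ?occ_ge0 //; have /andP[] := occ01 R y B i.
Qed.

(** Summing [weighted_avg_ge] over all windows of length [n * d] bounds [n] times the average of [G]
    below by minus their entropy, which is at least [- eta * n]. *)
Lemma avg_G_ge0 : asymle (fun=> 0) (avg G).
Proof.
apply: asymle_approx => eta eta0.
have d0 : (0 < d)%N by rewrite addn_gt0 w0 orbT.
have [n n0 Hn] := q_zero_entropy d eta d0 eta0.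
have nR : 0 < n%:R :> R by rewrite ltr0n.
apply: (asymle_trans (fun k => n%:R^-1 * (n%:R * avg G k))); last first.
  by apply: asymle_pointwise => k; rewrite mulKf ?lt0r_neq0.
apply: (asymle_trans (fun k => n%:R^-1 * \sum_(v : (n * d).-tuple bool) q v * ln (q v))).
  apply: asymle_pointwise => k; rewrite mulrC ler_pdivlMr //; lra.
apply: asymleZ; first by rewrite invr_ge0 ltW.
apply: (asymle_trans (avg (fun i => \sum_(j < n) G (i + (j * d + g))%N))); last first.
  apply: (asymle_trans (fun k => \sum_(j < n) avg (fun i => G (i + (j * d + g))%N) k)).
    by apply: asymle_pointwise => k; rewrite avg_sum.
  apply: (asymle_trans (fun k => \sum_(j < n) avg G k)).
    by apply: asymle_sum => j _; have [] := avg_shift R phi phi_incr G _ (j * d + g)%N G_bound.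
  by apply: asymle_pointwise => k; rewrite sumr_const card_ord -[leLHS]mulr_natl.
apply: (asymle_trans (fun k => \sum_(v : (n * d).-tuple bool) avg (fun i => occ R y v i *
     hit_weight (fun j => take (size w) (drop (j * d + g) v) == B) n i) k)); last first.
  apply: asymle_pointwise => k; rewrite -avg_sum; apply: avg_le => i.
  by rewrite sum_hit_weight.
by apply: asymle_sum => v _; apply: weighted_avg_ge.
Qed.

(** By [avg_G_ge0], [tau] times the joint frequency is asymptotically at least [- ln r * q B]. As
    [- ln r >= 1 - r] and [tau <= e / (1 - e)], the ratio [- ln r / tau] is at least
    [(1 - e) ^ 2 * cylprob w]. *)
Lemma joint_freq_ge_fixed :
  asymle (fun=> (1 - e) ^+ 2 * (cylprob w * q B)) (avg (fun i => occ R y B i * occ R a w i)).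
Proof.
have e01' := e01; have t0 := tau_gt0; have [r01 lr] := r_itv.
have q0 := q_ge0 R phi y q y_freq B.
have p0 := cylprob_gt0 R w pw.
have te : tau <= e / (1 - e).
  rewrite /tau -lnV ?posrE; last lra.
  have := @le_ln1Dx R (e / (1 - e)).
  rewrite (_ : 1 + e / (1 - e) = (1 - e)^-1); last by field; lra.
  by apply; apply: (@lt_le_trans _ _ 0); [lra|rewrite divr_ge0; lra].
apply: (asymle_trans (fun k => tau^-1 * (tau * avg (fun i => occ R y B i * occ R a w i) k))); last first.
  by apply: asymle_pointwise => k; rewrite mulKf ?lt0r_neq0.
apply: (asymle_trans (fun k => tau^-1 * (- ln r * q B))).
  apply: asymle_pointwise => k; rewrite [leRHS]mulrC ler_pdivlMr //.
  apply: (@le_trans _ _ ((1 - e) ^+ 2 * (cylprob w * q B) * (e / (1 - e)))).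
    apply: ler_wpM2l => //; apply: mulr_ge0; first exact: sqr_ge0.
    by apply: mulr_ge0 => //; exact: ltW.
  rewrite [leLHS](_ : _ = (1 - r) * q B); last by rewrite /r; field; lra.
  by apply: ler_wpM2r; lra.
apply: asymleZ; first by rewrite invr_ge0 ltW.
apply: (asymle_trans (fun k => 0 + - ln r * avg (occ R y B) k)).
  apply: (asymle_trans (fun k => - ln r * avg (occ R y B) k)).
    by apply: asymleZ; [lra|exact: cvg_asymge].
  by apply: asymle_pointwise => k; rewrite add0r.
apply: (asymle_trans (fun k => avg G k + - ln r * avg (occ R y B) k)).
  by apply: asymleD; [exact: avg_G_ge0|exact: asymle_pointwise].
apply: asymle_pointwise => k; rewrite -!avgZ -avgD; apply: avg_le => i.
by rewrite /G; lra.
Qed.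

End FixedParameters.

(* The Gauss system is mixing enough to be disjoint from zero entropy systems;
   only one inequality is needed. *)
Lemma joint_freq_ge w B : posdigits w -> size B = size w -> (0 < size w)%N ->
  asymle (fun=> cylprob w * q B) (avg (fun i => occ R y B i * occ R a w i)).
Proof.
move=> pw sB w0; apply: asymle_approx => eta eta0.
have q0 := q_ge0 R phi y q y_freq B.
have p0 := cylprob_gt0 R w pw.
pose z := cylprob w * q B.
have z0 : 0 <= z by rewrite mulr_ge0 // ltW.
(* This makes [2 * e * z <= eta], enough for [(1 - e) ^ 2 * z >= z - eta]. *)
pose e := Num.min (1 / 2) (eta / (2 * z + 1)).
have e01 : 0 < e < 1.
  have h : 0 < eta / (2 * z + 1) by apply: divr_gt0; lra.
  apply/andP; split; first by rewrite lt_min h andbT; lra.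
  by rewrite gt_min; apply/orP; left; lra.
have ez : e * (2 * z) <= eta.
  have : e * (2 * z + 1) <= eta by rewrite -ler_pdivlMr; [rewrite /e ge_min lexx orbT|lra].
  have : 0 < e by lra.
  lra.
have [g [M mix]] := gauss_mixing R e ltac:(lra).
apply: asymle_trans (joint_freq_ge_fixed e g M w B e01 mix pw sB w0).
apply: asymle_pointwise => k; rewrite -/z.
have : 0 <= e ^+ 2 * z by apply: mulr_ge0 => //; exact: sqr_ge0.
clearbody e z; nra.
Qed.

End ZeroEntropyIndependence.

(** * Gaps of the selected set *)

Section Subsequence.
Variables (R : realType) (phi : nat -> nat).
Hypothesis phi_incr : forall k, (phi k < phi k.+1)%N.
Variables (a : nat -> nat) (y : nat -> bool) (q : seq bool -> R).
Local Notation avg := (avg R phi).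
Local Notation asymle := (asymle R).
Local Notation cylprob := (cylprob R).
Hypothesis a_normal : forall u, posdigits u -> avg (occ R a u) @ \oo --> cylprob u.
Hypothesis y_freq : forall v, avg (occ R y v) @ \oo --> q v.
Hypothesis q_zero_entropy : forall (d : nat) (eta : R), (0 < d)%N -> 0 < eta ->
  exists2 n, (0 < n)%N & - \sum_(v : (n * d).-tuple bool) q v * ln (q v) <= eta * n%:R.
Variable s : nat -> nat.
Hypothesis s_incr : forall n, (s n < s n.+1)%N.
Hypothesis y_range : forall i, y i <-> exists n, s n = i.

Lemma occ_rcons v i : occ R y v i = occ R y (v ++ [:: true]) i + occ R y (v ++ [:: false]) i.
Proof.
by rewrite !occ_cat -mulrDr !occ1; case: (y _); rewrite /= ?addr0 ?add0r mulr1.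
Qed.

Lemma occ_cons v i : occ R y v i.+1 = occ R y (true :: v) i + occ R y (false :: v) i.
Proof.
rewrite -[true :: v]cat1s -[false :: v]cat1s !occ_cat /= addn1 -mulrDl !occ1.
by case: (y _); rewrite /= ?addr0 ?add0r mul1r.
Qed.

Lemma q_unique v (c : R) : asymle (avg (occ R y v)) (fun=> c) ->
  asymle (fun=> c) (avg (occ R y v)) -> q v = c.
Proof.
move=> H1 H2; apply/eqP; rewrite eq_le; apply/andP; split; apply: (@asymle_cst R).
  by apply: (asymle_trans _ (cvg_asymge _ _ _ (y_freq v))).
by apply: (asymle_trans _ H2); apply: cvg_asymle.
Qed.

Lemma q_rcons v : q v = q (v ++ [:: true]) + q (v ++ [:: false]).
Proof.
have E k : avg (occ R y v) k = avg (occ R y (v ++ [:: true])) k + avg (occ R y (v ++ [:: false])) k.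
  by rewrite -avgD; apply: eq_avg => i; apply: occ_rcons.
apply: q_unique.
  apply: (asymle_trans (fun k => avg (occ R y (v ++ [:: true])) k + avg (occ R y (v ++ [:: false])) k)).
    by apply: asymle_pointwise => k; rewrite E.
  by apply: asymleD; apply: cvg_asymle.
apply: (asymle_trans (fun k => avg (occ R y (v ++ [:: true])) k + avg (occ R y (v ++ [:: false])) k)).
  by apply: asymleD; apply: cvg_asymge.
by apply: asymle_pointwise => k; rewrite E.
Qed.

Lemma occ_norm v i : `|occ R y v i| <= 1.
Proof. by rewrite ger0_norm ?occ_ge0 //; have /andP[] := occ01 R y v i. Qed.

(** Shift invariance of the limiting frequencies, unlike [q_rcons], which is mere additivity. *)
Lemma q_cons v : q v = q (true :: v) + q (false :: v).
Proof.
have [S1 S2] := avg_shift R phi phi_incr (occ R y v) 1 1 (occ_norm v).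
have E k : avg (fun i => occ R y v (i + 1)%N) k = avg (occ R y (true :: v)) k + avg (occ R y (false :: v)) k.
  by rewrite -avgD; apply: eq_avg => i; rewrite addn1; apply: occ_cons.
apply: q_unique.
  apply: (asymle_trans _ S1).
  apply: (asymle_trans (fun k => avg (occ R y (true :: v)) k + avg (occ R y (false :: v)) k)).
    by apply: asymle_pointwise => k; rewrite E.
  by apply: asymleD; apply: cvg_asymle.
apply: (asymle_trans _ _ S2) => //.
apply: (asymle_trans (fun k => avg (occ R y (true :: v)) k + avg (occ R y (false :: v)) k)).
  by apply: asymleD; apply: cvg_asymge.
by apply: asymle_pointwise => k; rewrite E.
Qed.

Lemma q_nil : q [::] = 1.
Proof.
have E i : occ R y [::] i = 1 by [].
have [S1 S2] := avg_cst R phi phi_incr 1.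
apply: q_unique.
  by apply: (asymle_trans _ _ S2); apply: asymle_pointwise => k; apply: avg_le => i; rewrite E.
by apply: (asymle_trans _ S1); apply: asymle_pointwise => k; apply: avg_le => i; rewrite E.
Qed.

Let q0 := q_ge0 R phi y q y_freq.

(** A selected index followed by [K] unselected ones. Completed by [true], as in [gap_word j], it
    records a gap of length [j.+1]. *)
Definition tail_word K := true :: nseq K false.
Definition gap_word j := tail_word j ++ [:: true].

Lemma tail_word_rcons K : tail_word K ++ [:: false] = tail_word K.+1.
Proof. by rewrite /tail_word -addn1 nseqD. Qed.

(** By shift invariance the masses of the tail words telescope to at most [1], and they are
    nonincreasing. Hence gaps are almost surely finite. *)
Lemma q_tail_le K : K%:R * q (tail_word K) <= 1.
Proof.
have q1 : \sum_(j < K) q (tail_word j) = 1 - q (nseq K false).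
  elim: K => [|K IH]; first by rewrite big_ord0 q_nil subrr.
  by rewrite big_ord_recr /= IH (q_cons (nseq K false)) /tail_word; lra.
have mono j : (j <= K)%N -> q (tail_word K) <= q (tail_word j).
  elim: {q1} K => [|K IH]; first by case: j.
  rewrite leq_eqVlt => /predU1P[->//|/IH]; apply: le_trans.
  by rewrite (q_rcons (tail_word K)) tail_word_rcons lerDr.
apply: (@le_trans _ _ (\sum_(j < K) q (tail_word j))).
  have -> : K%:R * q (tail_word K) = \sum_(j < K) q (tail_word K) by rewrite sumr_const card_ord mulr_natl.
  by apply: ler_sum => j _; apply: mono; exact: ltnW.
by rewrite q1 gerBl.
Qed.

Lemma sum_q_gap K : \sum_(j < K) q (gap_word j) = q [:: true] - q (tail_word K).
Proof.
elim: K => [|K IH]; first by rewrite big_ord0 subrr.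
by rewrite big_ord_recr /= IH (q_rcons (tail_word K)) tail_word_rcons /gap_word; lra.
Qed.

Lemma sum_occ_gap K i : \sum_(j < K) occ R y (gap_word j) i <= 1.
Proof.
have -> : \sum_(j < K) occ R y (gap_word j) i = occ R y [:: true] i - occ R y (tail_word K) i.
  elim: K => [|K IH]; first by rewrite big_ord0 subrr.
  by rewrite big_ord_recr /= IH (occ_rcons (tail_word K)) tail_word_rcons /gap_word; lra.
have := occ_ge0 R y (tail_word K) i; have /andP[] := occ01 R y [:: true] i; lra.
Qed.

(** On the range of [s] this inverts [s]: it converts times along [a] into positions in the
    subsequence. *)
Definition rank m := (\sum_(i < m) y i)%N.

Lemma rankS m : rank m.+1 = (rank m + y m)%N.
Proof. by rewrite /rank big_ord_recr. Qed.

Lemma rank_gap i j : (forall l, (l < j)%N -> y (i + l) = false) -> rank (i + j) = rank i.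
Proof.
elim: j => [|j IH] H; first by rewrite addn0.
rewrite addnS rankS H // addn0 IH // => l lj.
by apply: H; rewrite (ltn_trans lj).
Qed.

Lemma s_mono m n : (m <= n)%N -> (s m <= s n)%N.
Proof.
elim: n => [|n IH]; first by case: m.
rewrite leq_eqVlt => /predU1P[->//|/IH h]; exact: leq_trans h (ltnW (s_incr n)).
Qed.

Lemma y_between n i : (s n < i < s n.+1)%N -> y i = false.
Proof.
move=> /andP[ni inS]; apply/negP => /y_range[m mi]; subst i.
have [mn|nm] := leqP m n; first by have := s_mono _ _ mn; lia.
by have := s_mono _ _ nm; lia.
Qed.

Lemma y_s n : y (s n).
Proof. by apply/y_range; exists n. Qed.

Lemma rank_s n : rank (s n) = n.
Proof.
elim: n => [|n IH].
  have -> : rank (s 0) = rank (0 + s 0) by [].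
  rewrite rank_gap; first by rewrite /rank big_ord0.
  move=> l l0; rewrite add0n; apply/negP => /y_range[m ml]; subst l.
  by have := s_mono 0 m (leq0n m); lia.
have := s_incr n => nS.
have -> : s n.+1 = ((s n).+1 + (s n.+1 - (s n).+1))%N by lia.
rewrite rank_gap; first by rewrite rankS IH y_s addn1.
by move=> l ll; apply: (y_between n); lia.
Qed.

Lemma s_rank i : y i -> s (rank i) = i.
Proof. by move=> /y_range[n <-]; rewrite rank_s. Qed.

Lemma rank_mono m n : (m <= n)%N -> (rank m <= rank n)%N.
Proof.
elim: n => [|n IH]; first by case: m.
rewrite leq_eqVlt => /predU1P[->//|/IH h]; rewrite rankS; exact: leq_trans h (leq_addr _ _).
Qed.

Lemma rank_cvg : (rank \o phi) @ \oo --> \oo.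
Proof.
move=> A [K _ KA]; exists (s K) => // k /= Kk; apply: KA => /=.
rewrite -(rank_s K); apply: rank_mono; apply: (leq_trans Kk); exact: leq_phi.
Qed.

Lemma sum_rank (F : nat -> R) m :
  \sum_(i < m) (y i)%:R * F (rank i) = \sum_(n < rank m) F n.
Proof.
elim: m => [|m IH]; first by rewrite big_ord0 /rank !big_ord0.
rewrite big_ord_recr /= IH rankS; case: (y m); rewrite ?addn0 ?mul0r ?addr0 //.
by rewrite addn1 big_ord_recr /= mul1r.
Qed.

Hypothesis sub_normal : (fun n => n%:R^-1 * \sum_(i < n) occ R (a \o s) [:: 20%N; 20%N] i)
  @ \oo --> cylprob [:: 20%N; 20%N].

Let pair_at i : R := (y i)%:R * occ R (a \o s) [:: 20%N; 20%N] (rank i).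

(** Summing over selected times is summing over the first [rank (phi k)] positions, so the average
    is the density of the selected set times a frequency along the subsequence. *)
Lemma avg_pair_cvg : avg pair_at @ \oo --> q [:: true] * cylprob [:: 20%N; 20%N].
Proof.
have E k : avg pair_at k = avg (occ R y [:: true]) k *
    ((rank (phi k))%:R^-1 * \sum_(n < rank (phi k)) occ R (a \o s) [:: 20%N; 20%N] n).
  rewrite /avg sum_rank.
  have -> : \sum_(i < phi k) occ R y [:: true] i = (rank (phi k))%:R.
    rewrite /rank natr_sum; apply: eq_bigr => i _.
    by rewrite occ1; case: (y i).
  have [->|r0] := eqVneq (rank (phi k)) 0%N; first by rewrite big_ord0 !mulr0 ?mul0r.
  by rewrite mulrA mulfK ?pnatr_eq0.
rewrite (funext E); apply: cvgM; first exact: y_freq.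
exact: (cvg_comp _ _ rank_cvg sub_normal).
Qed.

Let ends_at j i : R := ((a i == 20) && (a (i + j.+1) == 20))%:R.

(** When [gap_word j] occurs at [i], the next selected index is [i + j.+1], so the two digits are
    consecutive in the subsequence. Gaps longer than [K] are dropped, whence an inequality. *)
Lemma gap_ends_le K i :
  \sum_(j < K) occ R y (gap_word j) i * ends_at j i <= pair_at i.
Proof.
have P0 : 0 <= pair_at i by rewrite mulr_ge0 ?occ_ge0.
apply: (@le_trans _ _ ((\sum_(j < K) occ R y (gap_word j) i) * pair_at i)); last first.
  by rewrite ler_piMl // sum_occ_gap.
rewrite mulr_suml; apply: ler_sum => j _.
rewrite {1 2}/occ; case: eqP => [E|_]; last by rewrite !mul0r.
rewrite !mul1r /ends_at /pair_at.
have nE l : (l < j.+2)%N -> y (i + l) = nth true (gap_word j) l.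
  move=> lj; rewrite -E nth_word //.
  by rewrite /gap_word size_cat /= size_nseq addn1.
have yi : y i by have := nE 0%N isT; rewrite addn0 => ->.
have yj : y (i + j.+1).
  by rewrite nE // /gap_word /tail_word /= nth_cat size_nseq ltnn subnn.
have rj : rank (i + j.+1) = (rank i).+1.
  rewrite -addSnnS rank_gap ?rankS ?yi ?addn1 // => l lj.
  by rewrite addSnnS nE /gap_word /tail_word /= ?nth_cat ?size_nseq ?lj ?nth_nseq ?lj //; lia.
rewrite yi mul1r (occ_cat _ _ _ [:: 20%N] [:: 20%N]) !occ1 /= addn1.
by rewrite (s_rank i yi) -rj (s_rank _ yj) -natrM mulnb.
Qed.

Lemma ends_ge_words M j i :
  \sum_(c <- words M j) occ R a (20%N :: c ++ [:: 20%N]) i <= ends_at j i.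
Proof.
rewrite big_seq; under eq_bigr => c cin.
  rewrite -cat1s !occ_cat /= (words_size _ _ _ cin) mulrCA; over.
rewrite -big_seq -mulr_suml.
have S1 : \sum_(c <- words M j) occ R a c (i + 1)%N <= 1.
  have := sum_occ R a (words M j) (fun=> 1) (i + 1)%N (words_uniq M j) (@words_size M j).
  under eq_bigr do rewrite mul1r.
  by move=> ->; rewrite mulr1; case: (_ \in _); rewrite ?ler01 ?lexx.
apply: (le_trans (ler_wpM2r _ S1)); first by rewrite mulr_ge0 ?occ_ge0.
by rewrite mul1r /ends_at !occ1 -natrM mulnb -addnA add1n.
Qed.

(** The digit word [20 u 20] and [gap_word j] have the same length [j + 2], so [joint_freq_ge]
    applies to each [u]. *)
Lemma gap_ends_avg_ge j (c : R) M : c <= \sum_(u <- words M j) cylprob (20%N :: u ++ [:: 20%N]) ->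
  asymle (fun=> q (gap_word j) * c) (avg (fun i => occ R y (gap_word j) i * ends_at j i)).
Proof.
move=> cM.
apply: (asymle_trans (fun k => \sum_(u <- words M j) avg (fun i => occ R y (gap_word j) i *
    occ R a (20%N :: u ++ [:: 20%N]) i) k)); last first.
  apply: asymle_pointwise => k; rewrite -avg_sum; apply: avg_le => i.
  by rewrite -mulr_sumr ler_wpM2l ?occ_ge0 // ends_ge_words.
apply: (asymle_trans (fun k => \sum_(u <- words M j) cylprob (20%N :: u ++ [:: 20%N]) * q (gap_word j))).
  by apply: asymle_pointwise => k; rewrite -mulr_suml mulrC ler_wpM2r.
apply: asymle_sum => u uin.
apply: (joint_freq_ge R phi phi_incr a y q a_normal y_freq q_zero_entropy) => //.
  rewrite -cat1s !posdigits_cat /= andbT; exact: (allP (words_pos M j)).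
by rewrite /gap_word /= !size_cat /= size_nseq (words_size _ _ _ uin).
Qed.

(** Gap [1] contributes with factor [lam] and every longer gap with at least [(1 + e) * lam], yet
    normality of the subsequence makes the total [q [:: true] * lam]. *)
Lemma q_10_eq0 : q [:: true; false] = 0.
Proof.
have [e e0 He] := cylprob_20_gap R.
set lam := cylprob [:: 20%N; 20%N] in He.
have lam0 : 0 < lam by apply: cylprob_gt0.
have key K : q (gap_word 0) + (1 + e) * \sum_(j < K) q (gap_word j.+1) <= q [:: true].
  suff : (q (gap_word 0) + (1 + e) * \sum_(j < K) q (gap_word j.+1)) * lam <= q [:: true] * lam.
    by rewrite ler_pM2r.
  apply: (@asymle_cst R); apply: (asymle_trans _ _ (cvg_asymle _ _ _ avg_pair_cvg)).
  apply: (asymle_trans (fun k => \sum_(j < K.+1) avg (fun i => occ R y (gap_word j) i * ends_at j i) k)); last first.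
    by apply: asymle_pointwise => k; rewrite -avg_sum; apply: avg_le => i; apply: gap_ends_le.
  apply: (asymle_trans (fun k => \sum_(j < K.+1) q (gap_word j) * (if j == 0%N :> nat then lam else (1 + e) * lam))).
    apply: asymle_pointwise => k; rewrite big_ord_recl /= mulrDl lerD2l mulr_sumr mulr_suml.
    by apply: ler_sum => j _; rewrite /bump /= add1n [leRHS]mulrCA mulrA lexx.
  apply: asymle_sum => -[j jK] _ /=; case: j jK => [|j] jK /=.
    by apply: (gap_ends_avg_ge 0 lam 0%N); rewrite big_seq1 lexx.
  by have [M HM] := He j; apply: (gap_ends_avg_ge j.+1 _ M).
have q2 : q [:: true] = q (gap_word 0) + q [:: true; false] by rewrite (q_rcons [:: true]).
(* Up to the mass of [tail_word], the gaps account for all of [q [:: true]]; the surplus is thus at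
   most of the order of that mass, which vanishes by [q_tail_le]. *)
have bound K : e * q [:: true; false] <= (1 + e) * q (tail_word K.+1).
  have h1 := sum_q_gap K.+1; rewrite big_ord_recl in h1.
  have {h1} h : \sum_(j < K) q (gap_word j.+1) = q [:: true; false] - q (tail_word K.+1).
    by move: h1; rewrite q2 /=; lra.
  by have := key K; rewrite h q2; lra.
apply/eqP; rewrite eq_le q0 andbT leNgt; apply/negP => x0.
have ex : 0 < e * q [:: true; false] / 2 by rewrite divr_gt0 // mulr_gt0.
have [M HM] := small_inv_nat R (1 + e) _ ltac:(lra) ex.
have := HM M (leqnn M); have := bound M; have := q_tail_le M.+1.
rewrite -ler_pdivlMl ?ltr0n // mulr1 => h1 h2 h3.
have h4 : (1 + e) * q (tail_word M.+1) <= (1 + e) / M.+1%:R by apply: ler_wpM2l => //; lra.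
have := le_trans h2 (le_trans h4 h3); lra.
Qed.

End Subsequence.

(** * Derived measures as limiting window frequencies *)

Section DerivedMeasure.
Variable R : realType.

Local Notation bits z := (z : nat -> bool).

Lemma nbhs_word (n : nat) (z : cantor_space) :
  nbhs z [set z' : cantor_space | word (bits z') 0 n = word (bits z) 0 n].
Proof.
have Fz : Filter (nbhs z) by apply: nbhs_filter.
elim: n => [|n IH].
  by apply: (@filterS _ _ Fz setT) => //; exact: filterT.
have H : nbhs z [set z' : cantor_space | bits z' n = bits z n].
  have := @proj_continuous nat (fun _ => bool) n z.
  by move=> /(_ [set b | b = bits z n]); apply; exact: discrete_set1.
apply: (@filterS2 _ _ Fz _ _ _ _ IH H) => z' E En.
by rewrite /= -addn1 !word_cat E /word /mkseq /= !addn0 En.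
Qed.

Lemma word_fun_continuous (T : topologicalType) (n : nat) (h : seq bool -> T) :
  continuous (fun z : cantor_space => h (word (bits z) 0 n)).
Proof.
move=> z A hA; have Fz : Filter (nbhs z) by apply: nbhs_filter.
apply: (@filterS _ _ Fz _ _ _ (nbhs_word n z)) => z' /= ->.
exact: nbhs_singleton.
Qed.

Lemma word_set_measurable (n : nat) (h : seq bool -> bool) :
  measurable ([set z | h (word (bits z) 0 n)] : set cantorB).
Proof.
apply: sub_sigma_algebra; rewrite /= openE => z /= hz.
have Fz : Filter (nbhs z) by apply: nbhs_filter.
by apply: (@filterS _ _ Fz _ _ _ (nbhs_word n z)) => z' /= ->.
Qed.

Variables (S : set nat) (mu : probability cantorB R) (phi : nat -> nat).
Let y : nat -> bool := Defs.indic S.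
Hypothesis mu_lim : forall f : cantor_space -> R, continuous f ->
  (fun k => (phi k)%:R^-1 * \sum_(i < phi k) f (Defs.shift (Defs.indic S) i)) @ \oo -->
    fine (\int[mu]_z (f z)%:E)%E.

Lemma word_shift i n : word (bits (Defs.shift (Defs.indic S) i)) 0 n = word y i n.
Proof. by apply: eq_map => j /=; rewrite add0n /Defs.shift addnC. Qed.

(** The indicator of a set determined by finitely many coordinates is continuous, so weak-*
    convergence applies to it. *)
Lemma word_set_freq (n : nat) (h : seq bool -> bool) :
  avg R phi (fun i => (h (word y i n))%:R) @ \oo -->
    fine (mu [set z | h (word (bits z) 0 n)]).
Proof.
have := mu_lim _ (@word_fun_continuous R n (fun u => (h u)%:R)).
set A := [set z | _].
have -> : (\int[mu]_z (h (word (bits z) 0 n))%:R%:E)%E = mu A.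
  rewrite -[in RHS](setIT A) -integral_indic //; last exact: word_set_measurable.
  apply: eq_integral => z _; rewrite indicE; congr (_%:R%:E).
  by rewrite /A; case: (boolP (h _)) => hz; [rewrite mem_set|rewrite memNset //; apply/negP].
rewrite (_ : (fun k => _) = avg R phi (fun i => (h (word y i n))%:R)) //.
by apply/funext => k; congr (_ * _); apply: eq_bigr => i _; rewrite word_shift.
Qed.

Definition cyl_mass (v : seq bool) : R :=
  fine (mu [set z | word (bits z) 0 (size v) == v]).

Lemma cyl_mass_freq v : avg R phi (occ R y v) @ \oo --> cyl_mass v.
Proof. exact: (word_set_freq (size v) (fun u => u == v)). Qed.

Lemma bcyl_word n (v : n.-tuple bool) : bcyl v = [set z | word (bits z) 0 (size v) == v].
Proof.
apply/seteqP; split=> z /=.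
  move=> H; apply/eqP/(@eq_from_nth _ false); rewrite size_word // => j jn.
  rewrite nth_word // add0n; rewrite size_tuple in jn.
  by rewrite (H (Ordinal jn)) (tnth_nth false).
move=> /eqP E i; rewrite (tnth_nth false) -E nth_word ?size_tuple ?add0n //.
Qed.

Lemma cyl_mass_zero_entropy : zero_entropy mu ->
  forall (d : nat) (eta : R), (0 < d)%N -> 0 < eta ->
  exists2 n, (0 < n)%N &
    - \sum_(v : (n * d).-tuple bool) cyl_mass v * ln (cyl_mass v) <= eta * n%:R.
Proof.
move=> + d eta d0 eta0.
have dR : 0 < d%:R :> R by rewrite ltr0n.
move=> /cvgrPdist_le /(_ (eta / d%:R) (divr_gt0 eta0 dR)) [N _ HN].
exists N.+1 => //.
(* The entropy sequence is indexed by [n.+1], so windows of length [N.+1 * d] sit at index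
   [(N.+1 * d).-1]. *)
have p : (0 < N.+1 * d)%N by rewrite muln_gt0.
have := HN (N.+1 * d).-1; rewrite /= (prednK p) => /(_ _).
have pR : 0 < (N.+1 * d)%:R :> R by rewrite ltr0n.
have NN : (N <= (N.+1 * d).-1)%N by nia.
move=> /(_ NN); rewrite sub0r normrN => /(le_trans (ler_norm _)).
rewrite ler_pdivrMr // natrM mulrCA divfK ?lt0r_neq0 // mulrC.
apply: le_trans; rewrite /Hn lerN2.
by apply: ler_sum => v _; rewrite /cyl_mass bcyl_word.
Qed.

(** Off the null set where some consecutive coordinates differ, only the two constant sequences
    remain; the weight [t] is the mass of the zero sequence. *)
Lemma in_conv01_of_no_change : (forall j,
    mu [set z | nth false (word (bits z) 0 j.+2) j != nth false (word (bits z) 0 j.+2) j.+1] = 0%E) ->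
  in_conv01 mu.
Proof.
move=> H.
pose c0 : cantorB := fun _ : nat => false.
pose c1 : cantorB := fun _ : nat => true.
pose D j : set cantorB := [set z | nth false (word (bits z) 0 j.+2) j != nth false (word (bits z) 0 j.+2) j.+1].
have mD j : measurable (D j).
  exact: (word_set_measurable j.+2 (fun u => nth false u j != nth false u j.+1)).
pose N := \bigcup_j D j.
have mN : measurable N by apply: bigcupT_measurable.
have muN : mu N = 0%E.
  apply/(negligibleP _ mN); apply: negligible_bigcup => j.
  by apply/negligibleP => //; exact: H.
have Nc z : ~ N z -> z = (if bits z 0%N then c1 else c0).
  move=> nz; apply/funext => j.
  have -> : z j = bits z 0%N.
    elim: j => // j <-; apply/eqP; rewrite eq_sym; apply/negPn/negP => zj; apply: nz.
    by exists j => //; rewrite /D /mkset !nth_word // !add0n.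
  by case: (bits z 0%N).
have Nc0 : ~ N c0 by move=> [j _]; rewrite /D /mkset !nth_word.
have Nc1 : ~ N c1 by move=> [j _]; rewrite /D /mkset !nth_word.
have mb b : measurable ([set z | bits z 0%N = b] : set cantorB).
  rewrite (_ : [set _ | _] = [set z | nth false (word (bits z) 0 1) 0 == b]).
    exact: (word_set_measurable 1 (fun u => nth false u 0 == b)).
  by apply/seteqP; split => z /=; rewrite /word /mkseq /= => /eqP.
(* A constant sequence is singled out by its first coordinate outside [N], so its singleton is
   measurable. *)
have m0 : measurable ([set c0] : set cantorB).
  rewrite (_ : [set c0] = [set z | bits z 0%N = false] `\` N); first exact: measurableD.
  apply/seteqP; split => [z -> //|z /= [z0 /Nc]]; by rewrite z0.
have m1 : measurable ([set c1] : set cantorB).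
  rewrite (_ : [set c1] = [set z | bits z 0%N = true] `\` N); first exact: measurableD.
  apply/seteqP; split => [z -> //|z /= [z0 /Nc]]; by rewrite z0.
have c01 : c0 <> c1 by move=> /(congr1 (fun z : nat -> bool => z 0%N)).
have split A : measurable A -> mu A = (mu (A `&` [set c0]) + mu (A `&` [set c1]))%E.
  move=> mA.
  have mA0 : measurable (A `&` [set c0]) by exact: measurableI.
  have mA1 : measurable (A `&` [set c1]) by exact: measurableI.
  have mA01 : measurable (A `&` ([set c0] `|` [set c1])) by apply: measurableI => //; exact: measurableU.
  rewrite -measureU //; last first.
    by apply/seteqP; split => z //= [[_ ->] [_ /c01]].
  rewrite -setIUr; apply/eqP; rewrite eq_le; apply/andP; split; last first.
    by apply: le_measure; rewrite ?inE //; apply: subIsetl.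
  apply: (@le_trans _ _ (mu ((A `&` ([set c0] `|` [set c1])) `|` N))).
    apply: le_measure; rewrite ?inE //; first exact: measurableU.
    move=> z Az; have [Nz|nNz] := pselect (N z); [by right|left; split => //].
    by rewrite (Nc z nNz) /=; case: (bits z 0%N); [right|left].
  have /le_trans := @measureU2 _ _ _ mu _ _ mA01 mN; apply.
  by rewrite [X in (_ + X <= _)%E]muN adde0.
have fin A : measurable A -> mu A \is a fin_num by move=> mA; exact: fin_num_measure.
pose t := fine (mu [set c0]).
have t0 : 0 <= t by apply: fine_ge0.
have mu0 : mu [set c0] = t%:E by rewrite /t fineK // fin.
have tot : (mu [set c0] + mu [set c1] = 1)%E.
  by have := split setT measurableT; rewrite !setTI probability_setT => <-.
have mu1 : mu [set c1] = (1 - t)%:E.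
  by rewrite EFinB -mu0 -tot addeAC subee ?add0e // fin.
exists t; split.
  have : (0 <= mu [set c1])%E by [].
  by rewrite mu1 lee_fin t0 subr_ge0.
move=> A mA; rewrite (split A mA).
have dir c (r : R) : mu [set c] = r%:E -> mu (A `&` [set c]) = (r%:E * \d_c A)%E.
  move=> mc; rewrite diracE; case: (boolP (c \in A)) => [/set_mem cA|/negP cA].
    rewrite mule1 -mc; congr (mu _); apply/seteqP; split => z /=; first by case.
    by move=> ->.
  rewrite mule0 (_ : A `&` [set c] = set0) ?measure0 //.
  by apply/seteqP; split => z //= [Az zc]; apply: cA; rewrite -zc mem_set.
by rewrite (dir c0 t mu0) (dir c1 (1 - t) mu1).
Qed.

Hypothesis phi_incr : forall k, (phi k < phi k.+1)%N.

(** Comparing [q_rcons] and [q_cons] on [[:: true]] shows that [01] and [10] have equal mass;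
    invariance under shifts then excludes a change at any position. *)
Lemma in_conv01_of_mass : cyl_mass [:: true; false] = 0 -> in_conv01 mu.
Proof.
move=> q10; apply: in_conv01_of_no_change => j.
have q01 : cyl_mass [:: false; true] = 0.
  have := q_rcons R phi y cyl_mass cyl_mass_freq [:: true].
  have := q_cons R phi phi_incr y cyl_mass cyl_mass_freq [:: true].
  rewrite /= q10; lra.
set A := [set z | _].
have mA : measurable (A : set cantorB).
  exact: (word_set_measurable j.+2 (fun u => nth false u j != nth false u j.+1)).
suff : fine (mu A) = 0.
  by move=> f0; rewrite -[mu A]fineK ?f0 //; exact: fin_num_measure.
apply/eqP; rewrite eq_le fine_ge0 // andbT.
apply: (@asymle_cst R).
apply: (asymle_trans _ (cvg_asymge _ _ _
  (word_set_freq j.+2 (fun u => nth false u j != nth false u j.+1)))).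
pose F i : R := occ R y [:: true; false] i + occ R y [:: false; true] i.
have FB i : `|F i| <= 2.
  have := occ01 R y [:: true; false] i; have := occ01 R y [:: false; true] i.
  by move=> /andP[? ?] /andP[? ?]; rewrite ler_norml /F; lra.
have [_ S2] := avg_shift R phi phi_incr F 2 j FB.
apply: (asymle_trans (avg R phi (fun i => F (i + j)%N))).
  apply: asymle_pointwise => k; apply: avg_le => i.
  rewrite !nth_word // /F.
  rewrite (occ_cat _ _ _ [:: true] [:: false]) (occ_cat _ _ _ [:: false] [:: true]) !occ1 /= addn1 addnS.
  by case: (y (i + j)); case: (y (i + j).+1); rewrite /= ?mulr1 ?mulr0 ?addr0 ?add0r.
apply: (asymle_trans _ S2).
apply: (asymle_trans (fun k => cyl_mass [:: true; false] + cyl_mass [:: false; true])).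
  apply: (asymle_trans (fun k => avg R phi (occ R y [:: true; false]) k + avg R phi (occ R y [:: false; true]) k)).
    by apply: asymle_pointwise => k; rewrite avgD.
  by apply: asymleD; apply: cvg_asymle; apply: cyl_mass_freq.
by apply: asymle_pointwise => k; rewrite q10 q01 addr0.
Qed.

End DerivedMeasure.

(** * From block counts to the theorem *)

Lemma block_count_occ (R : realType) (a : nat -> nat) (b : seq nat) n :
  (block_count a b n)%:R = \sum_(i < n) occ R a b i.
Proof.
rewrite /block_count -sum1_card natr_sum big_mkcond /=; apply: eq_bigr => i _.
have E : [forall j : 'I_(size b), a (i + j)%N == nth 0%N b j] = (word a i (size b) == b).
  apply/forallP/eqP => [H|E j].
    apply/(@eq_from_nth _ 0%N); rewrite size_word // => j jb.
    by rewrite nth_word // (eqP (H (Ordinal jb))).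
  by rewrite -(nth_word _ 0%N a i (size b) j) // E.
rewrite /occ -E; case: ifPn => [/set_mem /= ->//|/negP h].
by case: (boolP [forall j, _]) => // H; case: h; rewrite mem_set.
Qed.

Lemma cf_normal_occ (R : realType) (a : nat -> nat) : cf_normal_seq R a ->
  forall u, posdigits u ->
    (fun n => n%:R^-1 * \sum_(i < n) occ R a u i) @ \oo --> cylprob R u.
Proof.
move=> H u pu; rewrite -gauss_measure_cylinder //.
rewrite (_ : (fun n => _) = (fun n : nat => (block_count a u n)%:R / n%:R : R)); first exact: H.
by apply/funext => n; rewrite block_count_occ mulrC.
Qed.

Lemma increasing_cvg (phi : nat -> nat) : (forall k, (phi k < phi k.+1)%N) -> phi @ \oo --> \oo.
Proof.
move=> inc A [K _ KA]; exists K => // k /= Kk; apply: KA => /=.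
by apply: (leq_trans Kk); exact: leq_phi.
Qed.

Theorem mainTheorem8 (R : realType) (x : R) (s : nat -> nat) :
  0 <= x <= 1 ->
  cf_normal x ->
  (forall n, (s n < s n.+1)%N) ->
  deterministic R (range s) ->
  ~ superficial R (range s) ->
  ~ cf_normal_seq R (fun n => cf_digit x (s n)).
Proof.
(* If the subsequence were normal, every derived measure would lie in the convex hull, making the
   set superficial. *)
move=> _ xn s_incr det nsup subn; apply: nsup => mu mu_der.
have ze := det mu mu_der.
have [phi [phi_incr mu_lim]] := mu_der.
apply: (in_conv01_of_mass R (range s) mu phi mu_lim phi_incr).
apply: (q_10_eq0 R phi phi_incr (cf_digit x) (Defs.indic (range s)) (cyl_mass R mu) _
  (cyl_mass_freq R (range s) mu phi mu_lim) (cyl_mass_zero_entropy R mu ze) s s_incr).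
- move=> u pu; exact: (cvg_comp _ _ (increasing_cvg phi phi_incr) (cf_normal_occ R _ xn u pu)).
- move=> i; rewrite /Defs.indic; split => [/asboolP[n _ <-]|[n <-]]; first by exists n.
  by apply/asboolP; exists n.
- exact: (cf_normal_occ R _ subn [:: 20%N; 20%N] isT).
Qed.
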